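(* Let $X$ be a separable real rearrangement invariant function space on $[0,1]$. Then $X$ has the Daugavet property if and only if $X=L_1[0,1]$ endowed with its canonical norm $\|f\|_1=\int_0^1|f|\,d\mu$. (That is, the only separable real rearrangement invariant function space on $[0,1]$ with the Daugavet property is $L_1[0,1]$ in its canonical norm.)
   Context: $[0,1]$ carries Lebesgue measure $\mu$. A (real) Köthe function space on $[0,1]$ is a Banach space $X$ of equivalence classes, modulo equality a.e., of integrable functions such that: (i) if $|f|\le|g|$ a.e. with $f$ measurable and $g\in X$, then $f\in X$ and $\|f\|\le\|g\|$; (ii) $\boldsymbol{1}_A\in X$ for every measurable $A\subset[0,1]$. $X'\subset X^*$ denotes the space of integrals, i.e. functionals $f\mapsto\int fg\,d\mu$ with $g$ measurable and $gf\in L_1$ for all $f\in X$ (identified with $g$), with the norm of $X^*$; it is again a Köthe function space, and $X''=(X')'$. A Köthe function space $X$ on $[0,1]$ is rearrangement invariant (r.i.) if: (1) for every measure-preserving bijection $\tau$ of $[0,1]$ and integrable $f$, $f\in X$ iff $f\tau^{-1}\in X$, and then $\|f\|=\|f\tau^{-1}\|$; (2) $X'$ is a norming subspace of $X^*$ (so $X$ is isometrically a subspace of $X''$), and $X=X''$ or $X$ is the closed linear span of the simple integrable functions of $X''$; (3) $L_\infty[0,1]\subset X\subset L_1[0,1]$ with $\|f\|_X\le\|f\|_\infty$ for $f\in L_\infty[0,1]$ and $\|f\|_1\le\|f\|_X$ for $f\in X$. The equality $X=L_1[0,1]$ means equality as sets of functions with equal norms. A Banach space $X$ has the Daugavet property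 if $\|\mathrm{Id}+T\|=1+\|T\|$ for every rank-one operator $T:X\to X$. *)

(* Defs.v *)
From HB Require Import structures.
From mathcomp Require Import all_boot all_order all_algebra.
From mathcomp Require Import all_classical all_reals all_analysis.

Set Implicit Arguments.
Unset Strict Implicit.
Unset Printing Implicit Defensive.

Import Order.TTheory GRing.Theory Num.Theory.
Import numFieldNormedType.Exports HBSimple.

Local Open Scope classical_set_scope.
Local Open Scope ring_scope.

Section BanachSpaces.
Context {R : realType}.

Definition separable (V : normedModType R) : Prop :=
  exists2 D : set V, countable D & dense D.

Definition opnorm (V W : normedModType R) (T : V -> W) : \bar R :=
  ereal_sup [set (`|T x|)%:E | x in [set x : V | `|x| <= 1]].

Definition rank_one (V W : lmodType R) (T : V -> W) : Prop :=
  exists2 y : W, y != 0 & range T = range (fun a : R => a *: y).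

Definition daugavet_property (V : normedModType R) : Prop :=
  forall T : {linear V -> V}, continuous T -> rank_one T ->
    opnorm (fun x => x + T x) = (1 + opnorm T)%E.

End BanachSpaces.

Section UnitInterval.
Variable R : realType.

Local Notation I01 := (`[0%R, 1%R]%classic : set R).

(* Lebesgue measure on [0,1], realised as the measure on R concentrated on
   [0,1].  Functions on [0,1] are represented by functions on R: their values
   off [0,1] are irrelevant modulo equality mu-almost everywhere.  Measurable
   means Borel measurable; every Lebesgue measurable function agrees almost
   everywhere with a Borel one, so the equivalence classes are the same. *)
Definition mu01 : {measure set (measurableTypeR R) -> \bar R} :=
  mrestr (@lebesgue_measure R)
    (measurable_itv `[0%R, 1%R] : measurable (I01 : set (measurableTypeR R))).

End UnitInterval.

Notation L0 R := {mfun_ (mu01 R), measurableTypeR R >-> measurableTypeR R}.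

Section FunctionSpaces.
Variable R : realType.

Local Notation I01 := (`[0%R, 1%R]%classic : set R).
Local Notation mu := (mu01 R).
Local Notation L0 := (L0 R).

(* A space of equivalence classes is a normed space X given with the map
   cls : X -> L0 sending each vector to the class it is.  A function f belongs
   to the space when its class is in the range of cls. *)
Section OneSpace.
Variables (X : normedModType R) (cls : X -> L0).

Definition represents (x : X) (f : R -> R) : Prop :=
  measurable_fun setT f /\ (cls x : R -> R) = f %[ae mu].

Definition members : set (R -> R) := [set f | exists x, represents x f].

Definition members_unit_ball : set (R -> R) :=
  [set f | exists2 x, represents x f & `|x| <= 1].

End OneSpace.

Record koethe_function_space (X : completeNormedModType R) (cls : X -> L0)
    : Prop := {
  koethe_inj : injective cls ;
  koethe_lin : forall (a : R) (x y : X),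
    (cls (a *: x + y) : R -> R) = (fun t => a * cls x t + cls y t) %[ae mu] ;
  koethe_int : forall x, mu.-integrable setT (EFin \o (cls x : R -> R)) ;
  koethe_ideal : forall (f : R -> R) (x : X), measurable_fun setT f ->
    {ae mu, forall t, `|f t| <= `|cls x t| } ->
    exists2 y, represents cls y f & `|y| <= `|x| ;
  koethe_indic : forall A : set R, measurable A -> A `<=` I01 ->
    members cls (\1_A : R -> R) }.

(* The integrals on a space with underlying set of functions S. *)
Definition koethe_dual (S : set (R -> R)) : set (R -> R) :=
  [set g | measurable_fun setT g /\
     forall f, S f -> mu.-integrable setT (fun t => (f t * g t)%:E)].

(* The norm of the functional f |-> \int f g when B is the unit ball. *)
Definition integral_norm (B : set (R -> R)) (g : R -> R) : \bar R :=
  ereal_sup [set `|\int[mu]_t (f t * g t)%:E|%E | f in B].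

Definition linear_span (A : set (R -> R)) : set (R -> R) :=
  [set h | exists (n : nat) (a : 'I_n -> R) (s : 'I_n -> (R -> R)),
     (forall i, A (s i)) /\ h = (fun t => \sum_(i < n) a i * s i t)].

(* dual1 and dual2 are X' and X'' = (X')' as sets of functions; the norms take
   values in \bar R so that no supremum has to be assumed finite. *)
Section Duals.
Variables (X : normedModType R) (cls : X -> L0).

Definition dual1 : set (R -> R) := koethe_dual (members cls).

Definition dual1_norm : (R -> R) -> \bar R :=
  integral_norm (members_unit_ball cls).

Definition dual1_unit_ball : set (R -> R) :=
  [set g | dual1 g /\ (dual1_norm g <= 1)%E].

Definition dual2 : set (R -> R) := koethe_dual dual1.

Definition dual2_norm : (R -> R) -> \bar R := integral_norm dual1_unit_ball.

Definition dual2_simple : set (R -> R) :=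
  [set s : R -> R |
     (exists h : {sfun measurableTypeR R >-> R}, s = h :> (R -> R)) /\
     mu.-integrable setT (EFin \o s) /\ dual2 s].

Definition dual2_simple_closed_span : set (R -> R) :=
  [set h | dual2 h /\ forall e : R, 0 < e ->
     exists2 s, linear_span dual2_simple s &
       (dual2_norm (fun t => (h t - s t)%R) < e%:E)%E].

End Duals.

(* tau restricts to a measure-preserving bijection of [0,1] whose inverse is
   the restriction of tauV; nothing is required off [0,1]. *)
Record measure_preserving_bijection
    (tau tauV : {mfun measurableTypeR R >-> measurableTypeR R}) : Prop := {
  mpb_fun : set_fun I01 I01 tau ;
  mpb_funV : set_fun I01 I01 tauV ;
  mpb_can : {in I01, cancel tau tauV} ;
  mpb_canV : {in I01, cancel tauV tau} ;
  mpb_measure : forall A : set (measurableTypeR R), measurable A ->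
    mu (tau @^-1` A) = mu A }.

(* ri_norming says that X' is a norming subspace of X^*: the norm of X is the
   supremum of the integrals over the unit ball of X'. *)
Record rearrangement_invariant (X : completeNormedModType R) (cls : X -> L0)
    : Prop := {
  ri_koethe : koethe_function_space cls ;
  ri_invariant_mem : forall tau tauV, measure_preserving_bijection tau tauV ->
    forall f : R -> R, mu.-integrable setT (EFin \o f) ->
      (members cls f <-> members cls (f \o tauV)) ;
  ri_invariant_norm : forall tau tauV, measure_preserving_bijection tau tauV ->
    forall (f : R -> R) (x y : X), mu.-integrable setT (EFin \o f) ->
      represents cls x f -> represents cls y (f \o tauV) -> `|x| = `|y| ;
  ri_norming : forall x : X, dual2_norm cls (cls x) = (`|x|)%:E ;
  ri_bidual : members cls = dual2 cls \/
    members cls = dual2_simple_closed_span cls ;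
  ri_Linfty : forall f : R -> R, f \in Lfun mu +oo%E ->
    exists2 x, represents cls x f &
      ((`|x|)%:E <= Lnorm mu +oo%E (EFin \o f))%E ;
  ri_L1 : forall x : X, (cls x : R -> R) \in Lfun mu 1%E /\
    (Lnorm mu 1%E (EFin \o (cls x : R -> R)) <= (`|x|)%:E)%E }.

Definition equals_L1 (X : normedModType R) (cls : X -> L0) : Prop :=
  members cls = [set f | f \in Lfun mu 1%E] /\
  forall x : X, (`|x|)%:E = (\int[mu]_t (`|cls x t|)%:E)%E.

End FunctionSpaces.

(* Main.v *)
Require Import Defs.
From HB Require Import structures.
From mathcomp Require Import all_boot all_order all_algebra all_fingroup.
From mathcomp Require Import all_classical all_reals all_analysis.
From mathcomp Require Import measurable_realfun ess_sup_inf.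
From mathcomp Require Import ring lra zify.

(** Let the norm of the space be written [|x|] and the mean norm [norm1]. The
    mean norm is the smaller one.

    Suppose that the space has the Daugavet property.
    By truncation the space is normed by bounded integrals ([norming_test]).
    These are continuous in the mean, so balls are closed in the mean
    ([norm_lsc]) and averaging over the cells [[i/N, (i+1)/N[] is contractive
    ([avg_norm]), being a limit of averages of rearrangements. It is therefore
    enough to study step functions, where the norm is monotone and invariant
    under permutations of the cells. The norm [setnorm A] of an indicator only
    depends on the measure of [A]; it is at least that measure, and one for the
    whole interval.

    Applied to rank-one operators given by bounded integrals, the Daugavet
    property provides, for finitely many unit vectors [x], a slice of the unit
    ball whose elements [y] have integral almost one and satisfy
    [|y + x| > 2 - e] for all these [x] ([slices]); as slices are stable under
    averaging, one may take [y] to be a step function [s]. Take for [x] the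
    vectors [- 1_A], where [A] runs over the sets made of the least number of
    cells for which [setnorm A = 1]. If [s > e] on a non-negligible part [B] of
    [A], then [s - 1_A] has some cancellation, and its norm stays away from [2],
    because the indicator of the difference [A \ B] has norm less than one
    ([stepv_sub_ind]). Separability enters here: it implies that small sets have
    norm less than one ([separable_small_cell]), so that such sets [A] have
    measure bounded below and a bounded number of them covers the interval.
    Hence [s > e] only on a set [B] of arbitrarily small measure, although the
    integral of [s] over [B] is almost one. Replacing [s] by its mean on [B]
    shows that [setnorm B] is almost at most the measure of [B] ([small_set]).

    Covering a larger set by rearrangements of [B] gives the same bound for all
    cells ([setnorm_cell]). By the triangle inequality the norm of a step
    function is at most its mean norm, and so is the norm of every vector
    ([norm_norm1]). As the space is complete and step functions are dense in
    the mean, all integrable functions belong to it ([L1f_member]).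

    Conversely, the space of integrable functions has the Daugavet property. For
    an operator with range spanned by [e], any vector can be replaced by
    its normalised restriction to a cell where [e] has little mass, without
    making the image smaller; the sum of that restriction and its image is
    almost a sum of disjoint functions ([localize]). *)

Set Implicit Arguments.
Unset Strict Implicit.
Unset Printing Implicit Defensive.

Import Order.TTheory GRing.Theory Num.Theory.
Import numFieldNormedType.Exports.

Local Open Scope classical_set_scope.
Local Open Scope ring_scope.

(** * Integration on the unit interval *)

Section Integral01.
Variable R : realType.
Local Notation mu := (mu01 R).
Local Notation I01 := (`[0%R, 1%R]%classic : set R).

Implicit Types (f g h : R -> R) (M c : R).

Definition integ01 (f : R -> R) : R := \int[mu]_t f t.
Definition L1f (f : R -> R) : Prop := mu.-integrable setT (EFin \o f).

Lemma mu01E (A : set R) : mu A = lebesgue_measure (A `&` I01).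
Proof. by []. Qed.

Lemma mu01T : mu setT = 1%E.
Proof. by rewrite mu01E setTI lebesgue_measure_itv/= lte01 oppr0 adde0. Qed.

Lemma ae01 (P : R -> Prop) : (forall t, 0 <= t < 1 -> P t) -> {ae mu, forall t, P t}.
Proof.
move=> h; exists ([set t | ~ (0 <= t < 1)]); split.
- rewrite (_ : mkset _ = ~` `[0, 1[%classic); first exact: measurableC.
  by apply/seteqP; split => t /=; rewrite in_itv.
- apply/eqP; rewrite eq_le measure_ge0 andbT mu01E.
  rewrite -(lebesgue_measure_set1 (1 : R)) le_measure ?inE//=.
  + apply: measurableI => //.
    rewrite (_ : mkset _ = ~` `[0, 1[%classic); first exact: measurableC.
    by apply/seteqP; split => t /=; rewrite in_itv.
  + move=> t [/= /negP nt]; rewrite in_itv/= => /andP[t0 t1].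
    by apply/eqP; rewrite eq_le t1/= leNgt; apply: contra nt => ->; rewrite t0.
- by move=> t /= nP ht; apply: nP; exact: h.
Qed.

Lemma ae01S (P Q : R -> Prop) : (forall t, P t -> Q t) ->
  {ae mu, forall t, P t} -> {ae mu, forall t, Q t}.
Proof. by move=> PQ; exact: (@filterS _ (almost_everywhere mu) _). Qed.

Lemma ae01S2 (P1 P2 Q : R -> Prop) : (forall t, P1 t -> P2 t -> Q t) ->
  {ae mu, forall t, P1 t} -> {ae mu, forall t, P2 t} -> {ae mu, forall t, Q t}.
Proof. by move=> PQ; exact: (@filterS2 _ (almost_everywhere mu) _). Qed.

Lemma L1f_meas f : L1f f -> measurable_fun setT f.
Proof. by case/integrableP => /measurable_EFinP. Qed.

Lemma bounded_funP (f : R -> R) M : (forall t, `|f t| <= M) ->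
  [bounded f x | x in [set: measurableTypeR R]].
Proof.
move=> h; exists M; split; first by rewrite num_real.
by move=> x Mx t _ /=; rewrite (le_trans (h t)) ?ltW.
Qed.

Lemma L1f_bounded f M : measurable_fun setT f -> (forall t, `|f t| <= M) -> L1f f.
Proof.
move=> mf h; apply: measurable_bounded_integrable => //.
- by rewrite [X in (X < _)%E]mu01T ltry.
- exact: bounded_funP h.
Qed.

Lemma L1f_cst c : L1f (fun=> c).
Proof. by apply: (@L1f_bounded _ `|c|). Qed.

Lemma L1fD f g : L1f f -> L1f g -> L1f (fun t => f t + g t).
Proof. by move=> hf hg; exact: (integrableD measurableT hf hg). Qed.

Lemma L1fZ c f : L1f f -> L1f (fun t => c * f t).
Proof. by move=> hf; exact: (integrableZl measurableT c hf). Qed.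

Lemma L1fN f : L1f f -> L1f (fun t => - f t).
Proof. by move=> hf; exact: (integrableN hf). Qed.

Lemma L1fB f g : L1f f -> L1f g -> L1f (fun t => f t - g t).
Proof. by move=> hf hg; apply: L1fD => //; exact: L1fN. Qed.

Lemma L1f_norm f : L1f f -> L1f (fun t => `|f t|).
Proof. by move=> hf; exact: (integrable_norm hf). Qed.

Lemma L1fM f h M : L1f f -> measurable_fun setT h -> (forall t, `|h t| <= M) ->
  L1f (fun t => f t * h t).
Proof.
move=> hf mh hh.
exact: (integrableMl measurableT hf mh (bounded_funP hh)).
Qed.

Lemma L1f_sum n (f : 'I_n -> R -> R) : (forall i, L1f (f i)) ->
  L1f (fun t => \sum_(i < n) f i t).
Proof.
elim: n f => [|n IH] f hf.
  by under eq_fun do rewrite big_ord0; exact: L1f_cst.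
under eq_fun do rewrite big_ord_recr/=.
by apply: L1fD => //; exact: IH.
Qed.

Lemma ae_eqI (f g : R -> R) : {ae mu, forall t, f t = g t} ->
  (f : R -> R) = g %[ae mu].
Proof. by apply: ae01S => t ->. Qed.

Lemma ae_eqE (f g : R -> R) : (f : R -> R) = g %[ae mu] ->
  {ae mu, forall t, f t = g t}.
Proof. by apply: ae01S => t; apply. Qed.

Lemma integ01D f g : L1f f -> L1f g ->
  integ01 (fun t => f t + g t) = integ01 f + integ01 g.
Proof. by move=> hf hg; exact: RintegralD. Qed.

Lemma integ01B f g : L1f f -> L1f g ->
  integ01 (fun t => f t - g t) = integ01 f - integ01 g.
Proof. by move=> hf hg; exact: RintegralB. Qed.

Lemma integ01Z c f : L1f f -> integ01 (fun t => c * f t) = c * integ01 f.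
Proof. by move=> hf; exact: RintegralZl. Qed.

Lemma integ01_cst c : integ01 (fun=> c) = c.
Proof. by rewrite /integ01 Rintegral_cst// [X in fine X]mu01T mulr1. Qed.

Lemma integ01_sum n (f : 'I_n -> R -> R) : (forall i, L1f (f i)) ->
  integ01 (fun t => \sum_(i < n) f i t) = \sum_(i < n) integ01 (f i).
Proof.
elim: n f => [|n IH] f hf.
  by under [X in integ01 X]eq_fun do rewrite big_ord0; rewrite integ01_cst big_ord0.
under [X in integ01 X]eq_fun do rewrite big_ord_recr/=.
by rewrite integ01D ?IH ?big_ord_recr//; exact: L1f_sum.
Qed.

Lemma integ01_ge0 f : (forall t, 0 <= f t) -> 0 <= integ01 f.
Proof. by move=> h; apply: Rintegral_ge0 => t _. Qed.

Lemma integ01_ae f g : measurable_fun setT f -> measurable_fun setT g ->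
  {ae mu, forall t, f t = g t} -> integ01 f = integ01 g.
Proof.
move=> mf mg h; rewrite /integ01 /Rintegral; congr fine.
apply: ae_eq_integral => //; [exact/measurable_EFinP|exact/measurable_EFinP|].
by apply: (ae01S _ h) => t ->.
Qed.

Lemma L1f_ae f g : measurable_fun setT g ->
  {ae mu, forall t, f t = g t} -> L1f f -> L1f g.
Proof.
move=> mg h /integrableP[mf hf]; apply/integrableP; split.
  exact/measurable_EFinP.
rewrite (_ : (\int[mu]_x _)%E = (\int[mu]_x `|(EFin \o f) x|)%E)//.
apply: ae_eq_integral => //.
- by apply: measurableT_comp => //; exact/measurable_EFinP.
- exact: measurableT_comp.
- by apply: (ae01S _ h) => t /= ->.
Qed.

Lemma le_integ01 f g : L1f f -> L1f g -> {ae mu, forall t, f t <= g t} ->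
  integ01 f <= integ01 g.
Proof.
move=> hf hg h; rewrite -subr_ge0 -integ01B//.
rewrite (_ : integ01 _ = integ01 (fun t => Num.max 0 (g t - f t))).
  by apply: integ01_ge0 => t; rewrite le_max lexx.
have m1 := L1f_meas (L1fB hg hf).
apply: integ01_ae => //.
- exact: measurable_maxr.
- by apply: (ae01S _ h) => t ht; rewrite max_r// subr_ge0.
Qed.

Lemma le_norm_integ01 f : L1f f -> `|integ01 f| <= integ01 (fun t => `|f t|).
Proof. by move=> hf; exact: le_normr_Rintegral. Qed.

Lemma EFin_integ01 f : L1f f -> (integ01 f)%:E = (\int[mu]_t (f t)%:E)%E.
Proof. by move=> hf; rewrite fineK//; exact: integrable_fin_num. Qed.

Definition norm1 (f : R -> R) : R := integ01 (fun t => `|f t|).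

Lemma norm1_ge0 f : 0 <= norm1 f.
Proof. exact: integ01_ge0. Qed.

Lemma norm1D f g : L1f f -> L1f g -> norm1 (fun t => f t + g t) <= norm1 f + norm1 g.
Proof.
move=> hf hg; rewrite /norm1 -integ01D; try exact: L1f_norm.
apply: le_integ01; [exact/L1f_norm/L1fD|by apply: L1fD; exact: L1f_norm|].
by apply: aeW => t; exact: ler_normD.
Qed.

Lemma norm1_triangle f g h : L1f f -> L1f g -> L1f h ->
  norm1 (fun t => f t - h t) <= norm1 (fun t => f t - g t) + norm1 (fun t => g t - h t).
Proof.
move=> hf hg hh; rewrite (_ : (fun t => f t - h t) =
  (fun t => (f t - g t) + (g t - h t))); last by apply/funext => t; ring.
by apply: norm1D; exact: L1fB.
Qed.

Lemma norm1Z c f : L1f f -> norm1 (fun t => c * f t) = `|c| * norm1 f.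
Proof.
move=> hf; rewrite /norm1 -integ01Z; last exact: L1f_norm.
by congr integ01; apply/funext => t; rewrite normrM.
Qed.

Lemma norm1C f g : norm1 (fun t => f t - g t) = norm1 (fun t => g t - f t).
Proof. by congr integ01; apply/funext => t; rewrite distrC. Qed.

Lemma norm1_ae f g : measurable_fun setT f -> measurable_fun setT g ->
  {ae mu, forall t, f t = g t} -> norm1 f = norm1 g.
Proof.
move=> mf mg h; apply: integ01_ae; try exact: measurableT_comp.
by apply: (ae01S _ h) => t ->.
Qed.

Lemma norm1M f h M : L1f f -> measurable_fun setT h -> (forall t, `|h t| <= M) ->
  norm1 (fun t => f t * h t) <= M * norm1 f.
Proof.
move=> hf mh hM; rewrite /norm1 -integ01Z; last exact: L1f_norm.
apply: le_integ01.
- exact/L1f_norm/(L1fM hf mh hM).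
- exact/L1fZ/L1f_norm.
- by apply: aeW => t; rewrite normrM mulrC ler_wpM2r.
Qed.

Lemma integ01_close f g h M : L1f f -> L1f g -> measurable_fun setT h ->
  (forall t, `|h t| <= M) ->
  `|integ01 (fun t => f t * h t) - integ01 (fun t => g t * h t)|
    <= M * norm1 (fun t => f t - g t).
Proof.
move=> hf hg mh hM; rewrite -integ01B; try exact: (L1fM _ mh hM).
rewrite (_ : (fun t => _) = (fun t => (f t - g t) * h t)); last first.
  by apply/funext => t; rewrite mulrBl.
have hfg := L1fB hf hg.
exact: le_trans (le_norm_integ01 (L1fM hfg mh hM)) (norm1M hfg mh hM).
Qed.

Lemma norm1_0_ae f : L1f f -> norm1 f = 0 -> {ae mu, forall t, f t = 0}.
Proof.
move=> hf h0; have mf := L1f_meas hf.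
have e0 : (\int[mu]_t `|(EFin \o f) t| = 0)%E.
  by rewrite -[LHS](EFin_integ01 (L1f_norm hf)) -[RHS]/(0%:E); congr EFin.
have := (ae_eq_integral_abs mu measurableT (proj2 (measurable_EFinP _ _) mf)).1 e0.
by apply: ae01S => t /(_ I) [].
Qed.

(** Lebesgue measure is the sum of its restrictions to the interval and to the
    complement, and the second one does not charge the interval. *)
Lemma ge0_integral_mu01 (f : R -> \bar R) : measurable_fun setT f ->
  (forall t, 0 <= f t)%E ->
  (\int[mu]_t f t = \int[@lebesgue_measure R]_(t in I01) f t)%E.
Proof.
move=> mf f0.
have mI : measurable (I01 : set (measurableTypeR R)) by exact: measurable_itv.
have mC := measurableC mI.
pose m2 : {measure set (measurableTypeR R) -> \bar R} :=
  mrestr (@lebesgue_measure R) mC.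
have mfI : measurable_fun (I01 : set (measurableTypeR R)) f.
  exact: measurable_funTS.
transitivity (\int[measure_add mu m2]_(t in I01) f t)%E; last first.
  apply: eq_measure_integral => A mA _.
  transitivity (mu A + m2 A)%E; first exact: measure_addE.
  rewrite /m2/= /mrestr addeC -setDE; apply/esym.
  exact: (measureDI (@lebesgue_measure R) mA mI).
rewrite ge0_integral_measure_add//.
rewrite [X in (_ + X)%E](_ : _ = 0)%E ?adde0; last first.
  apply: null_set_integral => //.
  by rewrite /m2/= /mrestr setICr measure0.
rewrite (ge0_negligible_integral mC measurableT mf) ?setTD ?setCK//.
by rewrite mu01E setICl measure0.
Qed.

Lemma integrable_mu01 f : L1f f -> (@lebesgue_measure R).-integrable I01 (EFin \o f).
Proof.
move=> /integrableP[mf hf]; apply/integrableP; split.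
  exact: measurable_funTS.
rewrite -ge0_integral_mu01//; exact: measurableT_comp.
Qed.

End Integral01.

(** * Step functions on equal cells, averages and interval exchanges *)

Section Steps.
Variable R : realType.
Local Notation mu := (mu01 R).
Local Notation I01 := (`[0%R, 1%R]%classic : set R).
Implicit Types (f g h : R -> R) (t : R).

Definition cell (N i : nat) : set R := `[i%:R / N%:R, i.+1%:R / N%:R[%classic.

Definition step (N : nat) (v : 'I_N -> R) (t : R) : R :=
  \sum_(i < N) v i * \1_(cell N i) t.

Lemma measurable_cell N i : measurable (cell N i).
Proof. exact: measurable_itv. Qed.

Lemma cellE N i t : (0 < N)%N -> cell N i t <-> i%:R <= t * N%:R < i.+1%:R.
Proof.
move=> N0; rewrite /cell /= in_itv/= ler_pdivrMr ?ltr0n// ltr_pdivlMr ?ltr0n//.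
Qed.

Lemma cell_uniq N i j t : (0 < N)%N -> cell N i t -> cell N j t -> i = j.
Proof.
move=> N0 /(cellE _ _ N0)/truncn_def <- /(cellE _ _ N0)/truncn_def.
by [].
Qed.

Lemma cell_sub N (i : 'I_N) t : cell N i t -> 0 <= t < 1.
Proof.
have N0 : (0 < N)%N by case: i => i; exact: leq_trans.
move=> /(cellE _ _ N0)/andP[h1 h2].
have hN : 0 < N%:R :> R by rewrite ltr0n.
rewrite -(pmulr_lge0 _ hN) (le_trans _ h1) ?ler0n//=.
rewrite -(ltr_pM2r hN) mul1r (lt_le_trans h2)// ler_nat.
exact: ltn_ord.
Qed.

Lemma cell_ex N t : (0 < N)%N -> 0 <= t < 1 -> exists i : 'I_N, cell N i t.
Proof.
move=> N0 /andP[t0 t1].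
have hN : 0 < N%:R :> R by rewrite ltr0n.
have tN : 0 <= t * N%:R by rewrite mulr_ge0// ltW.
have iN : (Num.trunc (t * N%:R)%R < N)%N.
  by rewrite truncn_lt_nat// -[ltRHS]mul1r ltr_pM2r.
by exists (Ordinal iN); apply/(cellE _ _ N0); exact: truncn_itv.
Qed.

Lemma step_at N (v : 'I_N -> R) (i : 'I_N) t : cell N i t -> step v t = v i.
Proof.
have N0 : (0 < N)%N by case: i => i; exact: leq_trans.
move=> it; rewrite /step (bigD1 i)//= indicE mem_set// mulr1 big1 ?addr0// => j ji.
rewrite indicE memNset ?mulr0// => jt; move/eqP: ji; apply; apply/val_inj.
exact: (cell_uniq N0 jt it).
Qed.

Lemma step_out N (v : 'I_N -> R) t : ~~ (0 <= t < 1) -> step v t = 0.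
Proof.
move=> nt; rewrite /step big1// => i _; rewrite indicE memNset ?mulr0// => it.
by move/negP: nt; apply; exact: cell_sub it.
Qed.

(** Pointwise facts about step functions are checked on each cell, and off
    [[0, 1[], where all step functions vanish. *)
Lemma cell_case N (P : R -> Prop) t : (0 < N)%N -> (~~ (0 <= t < 1) -> P t) ->
  (forall i : 'I_N, cell N i t -> P t) -> P t.
Proof.
move=> N0 hout hin; have [h|h] := boolP (0 <= t < 1); last exact: hout.
by have [i it] := cell_ex N0 h; exact: hin it.
Qed.

Lemma step0 (v : 'I_0 -> R) t : step v t = 0.
Proof. by rewrite /step big_ord0. Qed.

Lemma stepD N (v w : 'I_N -> R) t : step (fun i => v i + w i) t = step v t + step w t.
Proof. by rewrite /step -big_split/=; apply: eq_bigr => i _; rewrite mulrDl. Qed.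

Lemma stepZ N c (v : 'I_N -> R) t : step (fun i => c * v i) t = c * step v t.
Proof. by rewrite /step big_distrr/=; apply: eq_bigr => i _; rewrite mulrA. Qed.

Lemma stepB N (v w : 'I_N -> R) t : step (fun i => v i - w i) t = step v t - step w t.
Proof.
by rewrite /step -sumrB; apply: eq_bigr => i _; rewrite mulrBl.
Qed.

Lemma step_norm N (v : 'I_N -> R) t : `|step v t| = step (fun i => `|v i|) t.
Proof.
case: N v => [|N] v; first by rewrite !step0 normr0.
apply: (@cell_case N.+1 (fun t => `|step v t| = step (fun i => `|v i|) t)) => //.
  by move=> ht; rewrite !step_out// normr0.
by move=> i it; rewrite !(step_at _ it).
Qed.

Lemma le_step N (v w : 'I_N -> R) t : (forall i, v i <= w i) -> step v t <= step w t.
Proof.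
move=> h; apply: ler_sum => i _; by rewrite ler_wpM2r.
Qed.

Lemma measurable_step N (v : 'I_N -> R) : measurable_fun setT (step v).
Proof.
rewrite /step; apply: measurable_sum => i; apply: measurable_funM => //.
by apply: measurable_indic; exact: measurable_cell.
Qed.

Lemma step_bdd N (v : 'I_N -> R) t : `|step v t| <= \sum_i `|v i|.
Proof.
rewrite /step (le_trans (ler_norm_sum _ _ _))//; apply: ler_sum => i _.
by rewrite normrM indicE normr_nat ler_piMr// lern1 leq_b1.
Qed.

Lemma L1f_step N (v : 'I_N -> R) : L1f (step v).
Proof. exact: L1f_bounded (measurable_step v) (step_bdd v). Qed.

Lemma L1f_indic (A : set R) : measurable A -> L1f (\1_A : R -> R).
Proof.
move=> mA; apply: (@L1f_bounded _ _ 1); first exact: measurable_indic.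
by move=> t; rewrite indicE normr_nat lern1 leq_b1.
Qed.

Lemma integ01_indic (A : set R) : measurable A -> integ01 (\1_A : R -> R) = fine (mu A).
Proof. by move=> mA; rewrite /integ01 /Rintegral integral_indic// setIT. Qed.

Lemma indic_bdd (A : set R) t : `|(\1_A : R -> R) t| <= 1.
Proof. by rewrite indicE normr_nat lern1 leq_b1. Qed.

Lemma integ01_cell N (i : 'I_N) : integ01 (\1_(cell N i) : R -> R) = N%:R^-1.
Proof.
have N0 : (0 < N)%N by case: i => i; exact: leq_trans.
rewrite integ01_indic ?mu01E; last exact: measurable_cell.
rewrite setIidl; last first.
  by move=> t /cell_sub/andP[t0 t1]; rewrite /= in_itv/= t0 ltW.
rewrite lebesgue_measure_itv/= lte_fin ltr_pM2r ?invr_gt0 ?ltr0n// ltr_nat ltnSn/=.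
by rewrite -mulrBl -natrB// subSnn mul1r.
Qed.

Lemma integ01_step N (v : 'I_N -> R) : integ01 (step v) = (\sum_i v i) / N%:R.
Proof.
rewrite /step integ01_sum; last first.
  by move=> i; apply: L1fZ; apply: L1f_indic; exact: measurable_cell.
rewrite mulr_suml; apply: eq_bigr => i _; rewrite integ01Z ?integ01_cell//.
by apply: L1f_indic; exact: measurable_cell.
Qed.

Lemma norm1_step N (v : 'I_N -> R) : norm1 (step v) = (\sum_i `|v i|) / N%:R.
Proof.
by rewrite -integ01_step; congr integ01; apply/funext => t; rewrite step_norm.
Qed.

Definition mean N f (i : 'I_N) : R := N%:R * integ01 (fun t => f t * \1_(cell N i) t).
Definition avg N f : R -> R := step (mean f : 'I_N -> R).

Lemma L1f_cut f (A : set R) : measurable A -> L1f f -> L1f (fun t => f t * \1_A t).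
Proof.
move=> mA hf; apply: (L1fM hf _ (@indic_bdd A)); exact: measurable_indic.
Qed.

Lemma meanB N f g : L1f f -> L1f g ->
  (mean (fun t => f t - g t) : 'I_N -> R) = (fun i => mean f i - mean g i).
Proof.
move=> hf hg; apply/funext => i; rewrite /mean -mulrBr; congr (_ * _).
have mc := @measurable_cell N i.
rewrite -integ01B; try exact: L1f_cut.
by congr integ01; apply/funext => t; rewrite mulrBl.
Qed.

Lemma sum_integ01_cells N f : L1f f -> (forall t, 0 <= f t) ->
  \sum_(i < N) integ01 (fun t => f t * \1_(cell N i) t) <= integ01 f.
Proof.
case: N => [|N] hf f0; first by rewrite big_ord0; exact: integ01_ge0.
have mc i := @measurable_cell N.+1 i.
rewrite -integ01_sum; last by move=> i; exact: L1f_cut.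
apply: le_integ01 => //; first by apply: L1f_sum => i; exact: L1f_cut.
apply: aeW => t; rewrite -[leRHS]mul1r -big_distrr/= mulrC ler_wpM2r//.
rewrite (_ : \sum_(i < N.+1) _ = step (fun i : 'I_N.+1 => 1) t); last first.
  by apply: eq_bigr => i _; rewrite mul1r.
apply: (@cell_case N.+1 (fun t => step (fun i : 'I_N.+1 => 1) t <= 1)) => //.
  by move=> ht; rewrite step_out.
by move=> i it; rewrite (step_at _ it).
Qed.

Lemma norm_cut f (A : set R) t : `|f t * \1_A t| = `|f t| * \1_A t.
Proof. by rewrite normrM indicE normr_nat. Qed.

Lemma norm1_avg N f : L1f f -> norm1 (avg N f) <= norm1 f.
Proof.
move=> hf; case: N => [|N].
  rewrite norm1_step big_ord0 mul0r; exact: norm1_ge0.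
apply: le_trans (sum_integ01_cells N.+1 (L1f_norm hf) (fun t => normr_ge0 _)).
rewrite norm1_step mulr_suml; apply: ler_sum => i _.
rewrite /mean normrM normr_nat mulrAC divff ?pnatr_eq0// mul1r.
have lc := L1f_cut (@measurable_cell N.+1 i) hf.
apply: le_trans (le_norm_integ01 lc) _; rewrite le_eqVlt; apply/orP; left.
by apply/eqP; congr integ01; apply/funext => t; rewrite norm_cut.
Qed.

Lemma avg_contract N f g : L1f f -> L1f g ->
  norm1 (fun t => avg N f t - avg N g t) <= norm1 (fun t => f t - g t).
Proof.
move=> hf hg; rewrite (_ : (fun t => avg N f t - _) = avg N (fun t => f t - g t)).
  exact/norm1_avg/L1fB.
by apply/funext => t; rewrite /avg meanB// stepB.
Qed.

Lemma avg_step N (v : 'I_N -> R) : avg N (step v) = step v.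
Proof.
congr step; apply/funext => i; rewrite /mean.
have N0 : (0 < N)%N by case: i => i; exact: leq_trans.
rewrite (_ : (fun t => _) = (fun t => v i * \1_(cell N i) t)).
  rewrite integ01Z ?integ01_cell; last by apply: L1f_indic; exact: measurable_cell.
  by rewrite mulrCA divff ?mulr1// gt_eqF// ltr0n.
apply/funext => t; rewrite indicE; have [/set_mem it|] := boolP (t \in cell N i).
  by rewrite (step_at _ it).
by rewrite !mulr0.
Qed.

Lemma lebesgue_shift (c : R) (A : set (measurableTypeR R)) : measurable A ->
  lebesgue_measure ((fun t : R => t + c) @^-1` A) = lebesgue_measure A.
Proof.
move=> mA.
have ms : measurable_fun setT ((fun t => t + c) : measurableTypeR R -> measurableTypeR R).
  exact: (@measurable_funD _ _ R setT id (fun=> c)).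
pose sh : {mfun measurableTypeR R >-> measurableTypeR R} :=
  HB.pack ((fun t => t + c) : measurableTypeR R -> measurableTypeR R)
    (isMeasurableFun.Build _ _ _ _ _ ms).
apply/esym; apply: (@lebesgue_measure_unique R (pushforward lebesgue_measure sh)) => //.
move=> _ [[a b]] _ <-; 
transitivity (lebesgue_measure `]a - c, b - c]%classic).
  by rewrite !lebesgue_measure_itv/= !lte_fin ltrD2r; case: ifP => // _; congr EFin; ring.
have {1}<- : (fun t => t + c) @^-1` `]a, b]%classic = `]a - c, b - c]%classic; last by [].
by apply/seteqP; split => t /=; rewrite !in_itv/= ltrBlDr lerBrDr.
Qed.

Section Rearrangement.
Variables (N : nat) (s : {perm 'I_N}).

(** An interval exchange transformation: translate the [i]-th cell onto the
    [s i]-th one. *)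
Definition exchange (t : R) : R :=
  t + step (fun i => ((s i)%:R - i%:R) / N%:R) t.

Lemma exchange_at (i : 'I_N) t : cell N i t ->
  exchange t = t + ((s i)%:R - i%:R) / N%:R.
Proof. by move=> it; rewrite /exchange (step_at _ it). Qed.

Lemma exchange_cell (i : 'I_N) t : cell N i t -> cell N (s i) (exchange t).
Proof.
move=> it; rewrite (exchange_at it).
have N0 : (0 < N)%N by case: i {it} => i; exact: leq_trans.
move/(cellE _ _ N0) : it => it; apply/(cellE _ _ N0).
rewrite mulrDl divfK ?gt_eqF ?ltr0n//.
by move: it; rewrite -!natr1 => /andP[h1 h2]; apply/andP; split; lra.
Qed.

Lemma exchange_out t : ~~ (0 <= t < 1) -> exchange t = t.
Proof. by move=> ht; rewrite /exchange step_out// addr0. Qed.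

Lemma measurable_exchange : measurable_fun setT exchange.
Proof. by apply: measurable_funD => //; exact: measurable_step. Qed.

Lemma step_exchange (v : 'I_N -> R) t : step v (exchange t) = step (v \o s) t.
Proof.
case: (posnP N) => N0.
  rewrite /step !big1// => i _; by move: (ltn_ord i); rewrite {2}N0.
apply: (@cell_case N (fun t => step v (exchange t) = step (v \o s) t)) => //.
  by move=> ht; rewrite exchange_out// !step_out.
by move=> i it; rewrite (step_at _ it) (step_at _ (exchange_cell it)).
Qed.

End Rearrangement.

Lemma exchangeK N (s : {perm 'I_N}) : cancel (exchange s) (exchange s^-1).
Proof.
move=> t; case: (posnP N) => N0.
  by rewrite /exchange /step !big1 ?addr0// => i _; move: (ltn_ord i); rewrite {2}N0.
apply: (@cell_case N (fun t => exchange s^-1 (exchange s t) = t)) => //.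
  by move=> ht; rewrite !exchange_out.
move=> i it; rewrite (exchange_at _ (exchange_cell s it)) (exchange_at s it) permK.
by rewrite -addrA -mulrDl addrA subrK subrr mul0r addr0.
Qed.

End Steps.

(** * Interval exchanges preserve measure; density of step functions *)

Section Exchanges.
Variable R : realType.
Local Notation mu := (mu01 R).
Local Notation I01 := (`[0%R, 1%R]%classic : set R).
Implicit Types (f g h : R -> R) (t : R).

Lemma mu01_cells N (B : set R) : (0 < N)%N -> measurable B ->
  fine (mu B) = \sum_(i < N) fine (lebesgue_measure (B `&` cell N i)).
Proof.
move=> N0 mB; have mc i := @measurable_cell R N i.
rewrite -integ01_indic//.
transitivity (integ01 (fun t => \sum_(i < N) (\1_(B `&` cell N i) : R -> R) t)).
  have mI := measurable_indic mB.
  apply: integ01_ae => //.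
    by apply: measurable_sum => i; apply: measurable_indic; exact: measurableI.
  apply: ae01 => t /(cell_ex N0)[i it].
  rewrite (bigD1 i)//= big1 ?addr0; first by rewrite !indicE in_setI (mem_set it) andbT.
  move=> j ji; rewrite indicE in_setI (@memNset _ (cell N j) t) ?andbF// => jt.
  by move/eqP: ji; apply; apply/val_inj; exact: (cell_uniq N0 jt it).
have mBc i : measurable (B `&` cell N i) by exact: measurableI.
rewrite integ01_sum; last by move=> i; exact: L1f_indic.
apply: eq_bigr => i _; rewrite integ01_indic// mu01E setIidl//.
by move=> t [_ /cell_sub/andP[t0 t1]]; rewrite /= in_itv/= t0 ltW.
Qed.

Lemma mu01_fin (B : set R) : measurable B -> mu B \is a fin_num.
Proof.
move=> mB; rewrite ge0_fin_numE; last exact: measure_ge0.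
by rewrite (@le_lt_trans _ _ (mu setT)) ?le_measure ?inE// [X in (X < _)%E]mu01T ltry.
Qed.

(** Cell by cell, the map is a translation. *)
Lemma mu01_exchange N (s : {perm 'I_N}) (A : set R) : measurable A ->
  mu (exchange s @^-1` A) = mu A.
Proof.
move=> mA; have [N0|N0] := posnP N.
  congr (mu _); apply/seteqP; suff E t : exchange s t = t by split=> t /=; rewrite E.
  by rewrite /exchange /step big1 ?addr0// => i _; move: (ltn_ord i); rewrite {2}N0.
have mB : measurable (exchange s @^-1` A).
  by rewrite -[X in measurable X]setTI; exact: measurable_exchange.
rewrite -[LHS](fineK (mu01_fin mB)) -[RHS](fineK (mu01_fin mA)); congr EFin.
rewrite (mu01_cells N0 mB) (mu01_cells N0 mA).
rewrite [RHS](reindex_inj (@perm_inj _ s))/=; apply: eq_bigr => i _; congr fine.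
have mAc : measurable (A `&` cell N (s i)).
  by apply: measurableI => //; exact: measurable_cell.
rewrite -[RHS](lebesgue_shift (((s i)%:R - i%:R) / N%:R) mAc).
congr lebesgue_measure; apply/seteqP; split => t /=.
  by move=> [At it]; rewrite -(exchange_at s it); split=> //; exact: exchange_cell.
move=> [At sit]; have it : cell N i t.
  move: sit => /(cellE _ _ N0) h; apply/(cellE _ _ N0); move: h.
  rewrite mulrDl divfK ?gt_eqF ?ltr0n//.
  by rewrite -!natr1 => /andP[h1 h2]; apply/andP; split; lra.
by split => //; rewrite (exchange_at s it).
Qed.

Lemma integ01_exchange N (s : {perm 'I_N}) f : L1f f ->
  L1f (f \o exchange s) /\ integ01 (f \o exchange s) = integ01 f.
Proof.
move=> hf.
have me := @measurable_exchange R N s.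
have me' : measurable_fun setT (exchange s : measurableTypeR R -> measurableTypeR R) by [].
have E : forall A : set (measurableTypeR R), measurable A -> A `<=` setT ->
   mu A = pushforward mu (exchange s : measurableTypeR R -> measurableTypeR R) A.
  by move=> A mA _; rewrite /pushforward mu01_exchange.
have hf1 : L1f (f \o exchange s).
  case/integrableP : (hf) => mf fi; apply/integrableP; split.
    exact: (measurableT_comp mf me').
  have /= := @ge0_integral_pushforward _ _ _ _ _ _ me' mu setT (abse \o (EFin \o f)) measurableT.
  rewrite preimage_setT => <-//.
    by rewrite -(@eq_measure_integral _ _ _ _ _ mu _ E).
  exact: measurableT_comp.
split => //; rewrite /integ01 /Rintegral; congr fine.
have /= := @integral_pushforward _ _ _ _ _ _ me' mu setT (EFin \o f).
move=> /(_ (proj2 (measurable_EFinP _ _) (L1f_meas hf))).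
rewrite preimage_setT => /(_ hf1 measurableT) <-.
by rewrite -(@eq_measure_integral _ _ _ _ _ mu _ E).
Qed.

Lemma L1f_exchange N (s : {perm 'I_N}) f : L1f f -> L1f (f \o exchange s).
Proof. by move=> /(integ01_exchange s)[]. Qed.

Lemma norm1_exchange N (s : {perm 'I_N}) f : L1f f ->
  norm1 (f \o exchange s) = norm1 f.
Proof. by move=> /L1f_norm/(integ01_exchange s)[]. Qed.

Lemma exchange_mpb N (s : {perm 'I_N}) : exists tau tauV,
  [/\ measure_preserving_bijection tau tauV, tau = exchange s :> (R -> R)
    & tauV = exchange s^-1 :> (R -> R)].
Proof.
have me (p : {perm 'I_N}) : measurable_fun setT
  (exchange p : measurableTypeR R -> measurableTypeR R) by exact: measurable_exchange.
pose pk (p : {perm 'I_N}) : {mfun measurableTypeR R >-> measurableTypeR R} :=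
  HB.pack (exchange p : measurableTypeR R -> measurableTypeR R)
    (isMeasurableFun.Build _ _ _ _ _ (me p)).
have stable (p : {perm 'I_N}) : set_fun I01 I01 (exchange p).
  have [N0|N0] := posnP N.
    move=> t; rewrite /exchange /step big1 ?addr0// => i _; move: (ltn_ord i).
    by rewrite {2}N0.
  move=> t; apply: (@cell_case _ N (fun t => I01 t -> I01 (exchange p t))) => //.
    by move=> ht; rewrite exchange_out.
  move=> i it _; have /cell_sub := exchange_cell p it.
  by rewrite /= in_itv/= => /andP[-> /ltW ->].
exists (pk s), (pk s^-1%g); split => //; split => //.
- exact: stable.
- exact: stable.
- by move=> t _; exact: exchangeK.
- by move=> t _; rewrite /= -{1}(invgK s) exchangeK.
- by move=> A mA; exact: mu01_exchange.
Qed.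

(** Uniform continuity on the compact interval, with one of the two points
    allowed outside of it. *)
Lemma uniform_close (g : R -> R) e : continuous g -> 0 < e ->
  exists2 N0 : nat, (0 < N0)%N & forall N, (N0 <= N)%N -> forall x y,
    0 <= x <= 1 -> `|x - y| <= N%:R^-1 -> `|g x - g y| < e.
Proof.
move=> cg e0.
have cK : compact (`[0, 1]%classic : set R) by exact: segment_compact.
move/compact_near_coveringP : cK => /(_ nat \oo
  (fun N x => forall y, `|x - y| <= N%:R^-1 -> `|g x - g y| < e) _)/=.
case.
  move=> x _; have e2 : 0 < e / 2 by rewrite divr_gt0.
  have /(@cvgrPdist_lt _ _ _ _ _ _ _)/(_ _ e2)/= := cg x.
  move=> /nbhs_ballP[r /= r0 hr].
  exists (ball x (r / 2), [set N | N%:R^-1 < r / 2]) => /=.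
    split; first by apply: nbhsx_ballx; rewrite divr_gt0.
    have r2 : 0 < (r / 2)^-1 by rewrite invr_gt0 divr_gt0.
    exists (Num.trunc (r / 2)^-1).+1 => // N /= hN.
    have N0 : (0 : R) < N%:R by rewrite ltr0n (leq_trans _ hN).
    rewrite -[X in _ < X]invrK ltf_pV2 ?posrE//.
    by rewrite (lt_le_trans (truncnS_gt _))// ler_nat.
  move=> [x' N]/= [xx' hN] y xy.
  have h1 : `|g x - g x'| < e / 2.
    by apply: hr; apply: le_ball xx'; rewrite ler_pdivrMr// ler_pMr// ler1n.
  have h2 : `|g x - g y| < e / 2.
    apply: hr; rewrite /ball/= (le_lt_trans (ler_distD x' _ _))//.
    rewrite (splitr r) ltrD//.
    by apply: le_lt_trans xy _.
  rewrite (le_lt_trans (ler_distD (g x) _ _))// (splitr e) ltrD//.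
  by rewrite distrC.
move=> N0 _ h; exists N0.+1 => // N hN x y x01 xy.
by apply: (h N (ltnW hN) x) => //=; rewrite in_itv.
Qed.

Lemma L1f_lebesgue f : measurable_fun setT f ->
  (@lebesgue_measure R).-integrable I01 (EFin \o f) -> L1f f.
Proof.
move=> mf /integrableP[_ hf]; apply/integrableP; split; first exact/measurable_EFinP.
by rewrite ge0_integral_mu01//; apply: measurableT_comp => //; exact/measurable_EFinP.
Qed.

(** Continuous functions are dense, and a uniformly continuous function is
    close to its values at the left end points of small cells. *)
Lemma step_dense f d : L1f f -> 0 < d -> exists2 N0 : nat, (0 < N0)%N &
  forall N, (N0 <= N)%N -> exists v : 'I_N -> R, norm1 (fun t => f t - step v t) < d.
Proof.
move=> hf d0; have mI : measurable (I01 : set (measurableTypeR R)) by exact: measurable_itv.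
have lI : (@lebesgue_measure R I01 < +oo)%E.
  by rewrite lebesgue_measure_itv/= lte01 oppr0 adde0 ltry.
have [g_ [cg ig cv]] := approximation_continuous_integrable mI lI (integrable_mu01 hf).
have d2 : 0 < d / 2 by rewrite divr_gt0.
have [n hn] : exists n, (\int[@lebesgue_measure R]_(z in I01) `|(f z - g_ n z)%:E| < (d / 2)%:E)%E.
  case/fine_cvgP : cv => -[m1 _ h1] /cvgrPdist_lt/(_ _ d2)[m2 _ h2].
  exists (maxn m1 m2).
  have := h2 _ (leq_maxr m1 m2).
  rewrite /= sub0r normrN => /(le_lt_trans (ler_norm _)).
  by rewrite -lte_fin fineK//; apply: h1; exact: leq_maxl.
set g := g_ n in hn; have mg : measurable_fun setT g.
  exact: (continuous_measurable_fun (cg n)).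
have lg : L1f g by apply: L1f_lebesgue => //; exact: ig.
have [N0 N00 hN0] := uniform_close (cg n) d2.
exists N0 => // N hN; exists (fun i : 'I_N => g (i%:R / N%:R)).
have Npos : (0 < N)%N by exact: leq_trans hN.
have ls := L1f_step (fun i : 'I_N => g (i%:R / N%:R)).
apply: le_lt_trans (norm1_triangle hf lg ls) _; rewrite (splitr d).
apply: ltr_leD.
  have hfg := L1fB hf lg.
  rewrite -lte_fin (EFin_integ01 (L1f_norm hfg)) ge0_integral_mu01//.
  by apply/measurable_EFinP/measurableT_comp => //; exact: L1f_meas hfg.
rewrite -[leRHS]integ01_cst; apply: le_integ01.
- exact/L1f_norm/L1fB.
- exact: L1f_cst.
- apply: ae01 => t ht; have [i it] := cell_ex Npos ht.
  rewrite (step_at _ it); apply/ltW/(hN0 N hN) => //.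
    by case/andP : ht => -> /ltW ->.
  move: it; rewrite /cell/= in_itv/= -natr1 mulrDl mul1r => /andP[h1 h2].
  by rewrite ger0_norm ?subr_ge0// lerBlDl ltW.
Qed.

Lemma avg_cvg f d : L1f f -> 0 < d -> exists2 N0 : nat, (0 < N0)%N &
  forall N, (N0 <= N)%N -> norm1 (fun t => f t - avg N f t) < d.
Proof.
move=> hf d0; have d2 : 0 < d / 2 by rewrite divr_gt0.
have [N0 N00 hN0] := step_dense hf d2; exists N0 => // N /hN0[v hv].
have lv := L1f_step v; have la : L1f (avg N f) by exact: L1f_step.
apply: le_lt_trans (norm1_triangle hf lv la) _; rewrite (splitr d) ltrD//.
apply: le_lt_trans hv; rewrite -{1}(avg_step v) norm1C.
exact: avg_contract.
Qed.

End Exchanges.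

(** * Averages over permutations and refinement of cells *)

Section PermAverage.
Variables (R : numFieldType) (L : nat) (T : eqType) (p : 'I_L -> T).

Definition fibre_perms : {set {perm 'I_L}} :=
  [set s : {perm 'I_L} | [forall l, p (s l) == p l]]%SET.

Lemma fibre_permsP (s : {perm _}) : reflect (forall l, p (s l) = p l) (s \in fibre_perms).
Proof. by rewrite inE; apply: (iffP forallP) => h l; apply/eqP. Qed.

Lemma fibre_perms1 : (1%g : {perm 'I_L}) \in fibre_perms.
Proof. by apply/fibre_permsP => l; rewrite perm1. Qed.

Lemma card_fibre_perms_gt0 : (0 < #|fibre_perms|)%N.
Proof. by apply/card_gt0P; exists 1%g; exact: fibre_perms1. Qed.

(** Transpositions inside a fibre of [p] make the average over [fibre_perms]
    constant on that fibre, and each permutation preserves the sum over it; so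
    the average is the mean on the fibre. *)
Lemma fibre_perms_avg (w : 'I_L -> R) l :
  (\sum_(s in fibre_perms) w (s l)) * (\sum_(i | p i == p l) 1)
  = #|fibre_perms|%:R * \sum_(i | p i == p l) w i.
Proof.
have cst i : p i == p l ->
    \sum_(s in fibre_perms) w (s i) = \sum_(s in fibre_perms) w (s l).
  move=> /eqP pil; pose c := tperm i l.
  have cG s : (c * s \in fibre_perms)%g = (s \in fibre_perms).
    have pc k : p (c k) = p k by rewrite /c; case: tpermP => // ->.
    apply/fibre_permsP/fibre_permsP => h k.
      by have := h (c k); rewrite permM /c tpermK -/c pc.
    by rewrite permM h pc.
  rewrite (reindex_inj (mulgI c))/=; apply: eq_big => s; first exact: cG.
  by move=> _; rewrite permM /c tpermL.
transitivity (\sum_(i | p i == p l) \sum_(s in fibre_perms) w (s i)).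
  by rewrite big_distrr/=; apply: eq_bigr => i pil; rewrite mulr1 (cst i pil).
rewrite exchange_big/= mulr_natl -sumr_const; apply: eq_bigr => s /fibre_permsP sG.
by rewrite [RHS](reindex_inj (@perm_inj _ s))/=; apply: eq_bigl => i; rewrite sG.
Qed.

End PermAverage.

Section CardLemmas.
Variable L : nat.
Implicit Types A B : {set 'I_L}.

Lemma subset_of_card A k : (k <= #|A|)%N -> exists2 B : {set 'I_L}, B \subset A & #|B| = k.
Proof.
move=> /card_geqP[s [us ss sA]]; exists [set x in s]%SET.
  by apply/fintype.subsetP => x; rewrite inE; exact: sA.
by rewrite cardsE; move/card_uniqP : us ->.
Qed.

Lemma superset_of_card A k : (#|A| <= k)%N -> (k <= L)%N ->
  exists2 B : {set 'I_L}, A \subset B & #|B| = k.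
Proof.
move=> Ak kL.
have cA : (#|A| + #|~: A|)%N = L by rewrite cardsC card_ord.
have [|C CA cC] := @subset_of_card (~: A)%SET (L - k); first by lia.
exists (~: C)%SET; first by rewrite -(finset.setCK A) finset.setCS.
by have := cardsC C; rewrite card_ord; lia.
Qed.

(** The boolean characteristic sequences of [A] and [B] are permutations of each
    other. *)
Lemma perm_of_card A B : #|A| = #|B| ->
  exists s : {perm 'I_L}, forall i, (i \in A) = (s i \in B).
Proof.
move=> cAB.
pose tA := [tuple (i \in A) | i < L]; pose tB := [tuple (i \in B) | i < L].
have cnt (E : {set 'I_L}) : count_mem true [tuple (i \in E) | i < L] = #|E|.
  rewrite /= count_map -size_filter cardE /enum_mem; congr size.
  rewrite -filter_predI; apply: eq_filter => i /=.
  by rewrite eqb_id andbT.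
have cntF (E : {set 'I_L}) : count_mem false [tuple (i \in E) | i < L] = (L - #|E|)%N.
  have := count_predC (pred1 true) [tuple (i \in E) | i < L].
  rewrite cnt size_tuple (@eq_count _ (predC (pred1 true)) (pred1 false)); last by case.
  by move: (count_mem false _) => c; lia.
have /tuple_permP[s hs] : perm_eq tA tB.
  by apply/allP => -[] _; rewrite /= ?cnt ?cntF cAB.
exists s => i; have := congr1 (fun t => tnth t i) (val_inj hs).
by rewrite !tnth_mktuple.
Qed.
End CardLemmas.

Section Refine.
Variable R : realType.
Variables (L N K : nat) (eL : L = (N * K)%N).

Lemma blk_proof (l : 'I_L) : (l %/ K < N)%N.
Proof.
have := ltn_ord l; rewrite {2}eL; case: (posnP K) => [->|K0]; first by rewrite muln0.
by rewrite ltn_divLR.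
Qed.

(** The cell of the coarse partition that contains a given fine cell. *)
Definition blk (l : 'I_L) : 'I_N := Ordinal (blk_proof l).

Hypothesis K0 : (0 < K)%N.
Hypothesis N0 : (0 < N)%N.

Let L0 : (0 < L)%N. Proof. by rewrite eL muln_gt0 N0. Qed.

Let LR : L%:R = N%:R * K%:R :> R. Proof. by rewrite eL natrM. Qed.

Lemma cell_blk (l : 'I_L) (t : R) : cell L l t -> cell N (blk l) t.
Proof.
move=> /(cellE _ _ L0) h; apply/(cellE _ _ N0); move: h.
have k0 : 0 < K%:R :> R by rewrite ltr0n.
rewrite LR mulrA => /andP[h1 h2] /=; apply/andP; split.
  rewrite -(ler_pM2r k0) (le_trans _ h1)// -natrM ler_nat.
  exact: leq_trunc_div.
rewrite -(ltr_pM2r k0) (lt_le_trans h2)// -natrM ler_nat.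
by rewrite ltn_ceil.
Qed.

Lemma step_blk (v : 'I_N -> R) t : step v t = step (v \o blk) t.
Proof.
apply: (@cell_case _ L (fun t => step v t = step (v \o blk) t)) => //.
  by move=> ht; rewrite !step_out.
by move=> l lt; rewrite (step_at _ lt) (step_at _ (cell_blk lt)).
Qed.

(** Both sides are integrals of one step function, seen at two levels. *)
Lemma sum_blk (v : 'I_N -> R) : \sum_l v (blk l) = K%:R * \sum_i v i.
Proof.
have e : step v = step (v \o blk) by apply/funext => t; exact: step_blk.
have := congr1 (@integ01 R) e; rewrite !integ01_step LR.
have n0 : N%:R != 0 :> R by rewrite pnatr_eq0 -lt0n.
have k0 : K%:R != 0 :> R by rewrite pnatr_eq0 -lt0n.
move=> /(congr1 (fun z => z * (N%:R * K%:R))); rewrite divfK ?mulf_neq0// => <-.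
by rewrite mulrA divfK// mulrC.
Qed.

Lemma card_blk (A : {set 'I_N}) : #|[set l | blk l \in A]%SET| = (K * #|A|)%N.
Proof.
apply/eqP; rewrite -(eqr_nat R) natrM -!sum1_card !natr_sum.
have /= := sum_blk (fun i => (i \in A)%:R).
rewrite [X in X = _ -> _](_ : _ = \sum_(l in [set l | blk l \in A]%SET) 1%:R); last first.
  by rewrite [RHS]big_mkcond/=; apply: eq_bigr => l _; rewrite inE; case: ifP.
move=> ->; rewrite [X in _ * X == _](_ : _ = \sum_(i in A) 1%:R)//.
by rewrite [RHS]big_mkcond/=; apply: eq_bigr => l _; case: ifP.
Qed.

Lemma avg_step_blk (w : 'I_L -> R) t :
  avg N (step w) t =
  #|fibre_perms blk|%:R^-1 * \sum_(s in fibre_perms blk) step w (exchange s t).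
Proof.
apply: (@cell_case _ L (fun t => avg N (step w) t = #|fibre_perms blk|%:R^-1 *
   \sum_(s in fibre_perms blk) step w (exchange s t))) => //.
  move=> ht; rewrite /avg step_out// big1 ?mulr0// => s _.
  by rewrite step_exchange step_out.
move=> l lt; rewrite /avg (step_at _ (cell_blk lt)) /mean.
under [X in _ = _ * X]eq_bigr do rewrite step_exchange (step_at _ lt)/=.
have g0 : #|fibre_perms blk|%:R != 0 :> R.
  by rewrite pnatr_eq0 -lt0n card_fibre_perms_gt0.
have n0 : N%:R != 0 :> R by rewrite pnatr_eq0 -lt0n.
have k0 : K%:R != 0 :> R by rewrite pnatr_eq0 -lt0n.
have := fibre_perms_avg blk w l.
rewrite [X in _ * X = _](_ : _ = K%:R); last first.
  have := sum_blk (fun i => (i == blk l)%:R).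
  rewrite [X in _ = _ * X](bigD1 (blk l))//= eqxx.
  rewrite [X in _ = _ * (_ + X)]big1 ?addr0 ?mulr1; last first.
    by move=> i ni; rewrite (negbTE ni).
  by move=> <-; rewrite big_mkcond/=; apply: eq_bigr => i _; case: ifP.
move=> h; have -> : \sum_(s in fibre_perms blk) w (s l) =
  #|fibre_perms blk|%:R * (\sum_(i | blk i == blk l) w i) / K%:R.
  by rewrite -h mulfK.
rewrite -mulrA [RHS]mulrA mulVf// mul1r.
rewrite (_ : (fun t => _) = step (fun i => if blk i == blk l then w i else 0)).
  rewrite integ01_step -big_mkcond/= LR invfM.
  by rewrite mulrCA (mulrA N%:R) mulfV// mul1r.
apply/funext => u.
apply: (@cell_case _ L (fun u => step w u * \1_(cell N (blk l)) u =
  step (fun i => if blk i == blk l then w i else 0) u)) => //.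
  by move=> hu; rewrite !step_out// mul0r.
move=> i iu; rewrite !(step_at _ iu) indicE.
case: ifPn => [/eqP <-|il]; first by rewrite mem_set ?mulr1//; exact: cell_blk.
rewrite memNset ?mulr0// => lu; move/eqP: il; apply; apply/val_inj.
exact: (cell_uniq N0 (cell_blk iu) lu).
Qed.

End Refine.

(** * The norm and bounded integrals *)

Section Truncation.
Variable R : realType.
Local Notation mu := (mu01 R).
Implicit Types (f g h : R -> R) (t : R).

Definition truncate n g t : R := if `|g t| <= n%:R then g t else 0.

Lemma truncate_le n g t : `|truncate n g t| <= n%:R.
Proof. by rewrite /truncate; case: ifP => //; rewrite normr0. Qed.

Lemma truncateE n g : truncate n g = (fun t => g t * \1_[set t | `|g t| <= n%:R] t).
Proof.
apply/funext => t; rewrite /truncate indicE; case: ifPn => h.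
  by rewrite mem_set ?mulr1.
by rewrite memNset ?mulr0//; exact/negP.
Qed.

Lemma measurable_truncate_set n g : measurable_fun setT g ->
  measurable [set t | `|g t| <= n%:R].
Proof.
move=> mg; rewrite (_ : mkset _ = (fun t => `|g t|) @^-1` `]-oo, n%:R]%classic).
  by rewrite -[X in measurable X]setTI; exact: measurableT_comp.
by apply/seteqP; split => t /=; rewrite in_itv.
Qed.

Lemma measurable_truncate n g : measurable_fun setT g -> measurable_fun setT (truncate n g).
Proof.
move=> mg; rewrite truncateE; apply: measurable_funM => //.
by apply: measurable_indic; exact: measurable_truncate_set.
Qed.

Lemma truncate_cvg f g e : measurable_fun setT g -> L1f (fun t => f t * g t) -> 0 < e ->
  exists n, `|integ01 (fun t => f t * g t) - integ01 (fun t => f t * truncate n g t)| < e.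
Proof.
move=> mg hfg e0.
have hn n : L1f (fun t => f t * truncate n g t).
  rewrite truncateE (_ : (fun t => _) = (fun t => f t * g t * \1_[set t | `|g t| <= n%:R] t)).
    by apply: L1f_cut => //; exact: measurable_truncate_set.
  by apply/funext => t; rewrite mulrA.
have [|||_ _] := @dominated_convergence _ _ _ mu setT measurableT
  (fun n t => (f t * truncate n g t)%:E) (fun t => (f t * g t)%:E)
  (fun t => `|f t * g t|%:E) (fun n => measurable_int mu (hn n)) (measurable_int mu hfg).
- apply: aeW => t _; apply/fine_cvgP; split; first by apply: nearW.
  apply: cvg_near_cst; exists (Num.trunc `|g t|).+1 => // n /= hn'.
  rewrite /truncate ifT// (le_trans (ltW (truncnS_gt _)))// ler_nat.
  exact: hn'.
- exact: (L1f_norm hfg).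
- apply: aeW => t n _ /=; rewrite lee_fin !normrM ler_wpM2l// /truncate.
  by case: ifP => // _; rewrite normr0.
rewrite -(EFin_integ01 hfg) => /fine_cvgP[_ /cvgrPdist_lt/(_ _ e0)[n _ h]].
by exists n; exact: (h n (leqnn n)).
Qed.

End Truncation.

Section Space.
Variables (R : realType) (X : completeNormedModType R) (cls : X -> L0 R).
Hypothesis ri : rearrangement_invariant cls.
Local Notation mu := (mu01 R).
Implicit Types (f g h : R -> R) (t : R) (x y z : X).

Let ko : koethe_function_space cls := ri_koethe ri.

Lemma L1f_cls x : L1f (cls x).
Proof. exact: (koethe_int ko x). Qed.

Lemma measurable_cls x : measurable_fun setT (cls x).
Proof. exact: L1f_meas (L1f_cls x). Qed.

Lemma clsDZ a x y : {ae mu, forall t, cls (a *: x + y) t = a * cls x t + cls y t}.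
Proof. exact: ae_eqE (koethe_lin ko a x y). Qed.

Lemma cls_inj x y : {ae mu, forall t, cls x t = cls y t} -> x = y.
Proof.
move=> h; apply: (koethe_inj ko).
have /eqP : (cls x == cls y %[mod (L0 R)])%qT by apply/ae_eqP/ae_eqI.
by rewrite !generic_quotient.reprK.
Qed.

Lemma clsD x y : {ae mu, forall t, cls (x + y) t = cls x t + cls y t}.
Proof.
by have := clsDZ 1 x y; rewrite scale1r; apply: ae01S => t ->; rewrite mul1r.
Qed.

Lemma cls0 : {ae mu, forall t, cls 0 t = 0}.
Proof.
have := clsD 0 0; rewrite addr0; apply: ae01S => t h; lra.
Qed.

Lemma clsZ a x : {ae mu, forall t, cls (a *: x) t = a * cls x t}.
Proof.
have := clsDZ a x 0; rewrite addr0; apply: (ae01S2 _ cls0) => t h ->.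
by rewrite h addr0.
Qed.

Lemma clsB x y : {ae mu, forall t, cls (x - y) t = cls x t - cls y t}.
Proof.
have := clsDZ (-1) y x; rewrite scaleN1r addrC; apply: ae01S => t ->.
by rewrite mulN1r addrC.
Qed.

Lemma representsE x f : represents cls x f ->
  measurable_fun setT f /\ {ae mu, forall t, cls x t = f t}.
Proof. by case=> mf /ae_eqE. Qed.

Lemma representsI x f : measurable_fun setT f -> {ae mu, forall t, cls x t = f t} ->
  represents cls x f.
Proof. by move=> mf /ae_eqI. Qed.

Lemma norm_mono x y : {ae mu, forall t, `|cls x t| <= `|cls y t|} -> `|x| <= `|y|.
Proof.
move=> h; have [z /representsE[_ hz] zy] := koethe_ideal ko (measurable_cls x) h.
by rewrite (_ : x = z)//; apply: cls_inj; apply: ae01S hz => t ->.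
Qed.

Definition elt f : X := xget 0 [set x | represents cls x f].

Lemma eltP f x : represents cls x f -> elt f = x.
Proof.
move=> hx; rewrite /elt; case: xgetP => [y -> hy|/(_ x)//].
apply: cls_inj; have [_ h1] := representsE hx; have [_ h2] := representsE hy.
by apply: (ae01S2 _ h1 h2) => t -> ->.
Qed.

Lemma bounded_member f M : measurable_fun setT f -> (forall t, `|f t| <= M) ->
  exists2 x, represents cls x f & `|x| <= M.
Proof.
move=> mf hM.
have T0 : (0 < mu setT)%E by rewrite [X in (_ < X)%E]mu01T lte01.
have nf : (Lnorm mu +oo%E (EFin \o f) <= M%:E)%E.
  rewrite unlock /Lnorm T0; apply/ess_supP; apply: aeW => t /=.
  by rewrite lee_fin.
have hf : f \in Lfun mu +oo%E.
  rewrite inE/=; apply/andP; split; first by rewrite inE.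
  by rewrite inE/= /finite_norm (le_lt_trans nf)// ltry.
have [x hx nx] := ri_Linfty ri hf.
by exists x => //; rewrite -lee_fin (le_trans nx).
Qed.

Lemma elt_bounded f M : measurable_fun setT f -> (forall t, `|f t| <= M) ->
  {ae mu, forall t, cls (elt f) t = f t} /\ `|elt f| <= M.
Proof.
by move=> mf /(bounded_member mf)[x hx nx]; rewrite (eltP hx); case: (representsE hx).
Qed.

Lemma norm1_le x : norm1 (cls x) <= `|x|.
Proof.
have [_] := ri_L1 ri x; rewrite Lnorm1 -lee_fin; apply: le_trans.
by rewrite -[leRHS](EFin_integ01 (L1f_norm (L1f_cls x))).
Qed.

Definition pair h x : R := integ01 (fun t => cls x t * h t).

Definition bounded_fun h : Prop := measurable_fun setT h /\ exists M, forall t, `|h t| <= M.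

(** The bounded part of the unit ball of the space of integrals. Unlike general
    integrals, its elements are continuous for convergence in the mean. *)
Definition test h : Prop := bounded_fun h /\ forall z, `|pair h z| <= `|z|.

Lemma pairDZ h a x y : bounded_fun h -> pair h (a *: x + y) = a * pair h x + pair h y.
Proof.
move=> [mh [M hM]]; have lx := L1fM (L1f_cls x) mh hM.
have ly := L1fM (L1f_cls y) mh hM.
rewrite /pair -integ01Z// -integ01D//; last exact: L1fZ.
have lz := L1fM (L1f_cls (a *: x + y)) mh hM.
apply: integ01_ae.
- exact: L1f_meas.
- by apply: L1f_meas; apply: L1fD => //; exact: L1fZ.
- by apply: ae01S (clsDZ a x y) => t ->; rewrite mulrDl mulrA.
Qed.

Lemma pairD h x y : bounded_fun h -> pair h (x + y) = pair h x + pair h y.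
Proof. by move=> bh; rewrite -[x]scale1r pairDZ// mul1r scale1r. Qed.

Lemma pair0 h : bounded_fun h -> pair h 0 = 0.
Proof. by move=> bh; have := pairD 0 0 bh; rewrite addr0 => ?; lra. Qed.

Lemma pairZ h a x : bounded_fun h -> pair h (a *: x) = a * pair h x.
Proof. by move=> bh; rewrite -[_ *: x]addr0 pairDZ// pair0// addr0. Qed.

Lemma pairN h x : bounded_fun h -> pair h (- x) = - pair h x.
Proof. by move=> bh; rewrite -scaleN1r pairZ// mulN1r. Qed.

Lemma pair_comb h g a x : bounded_fun h -> bounded_fun g ->
  pair (fun t => h t + a * g t) x = pair h x + a * pair g x.
Proof.
move=> [mh [M hM]] [mg [M' hM']]; have lx := L1fM (L1f_cls x) mh hM.
have ly := L1fM (L1f_cls x) mg hM'.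
rewrite /pair -integ01Z// -integ01D//; last exact: L1fZ.
by congr integ01; apply/funext => t; ring.
Qed.

Lemma bounded_comb h g a : bounded_fun h -> bounded_fun g ->
  bounded_fun (fun t => h t + a * g t).
Proof.
move=> [mh [M hM]] [mg [M' hM']]; split.
  by apply: measurable_funD => //; exact: measurable_funM.
exists (M + `|a| * M') => t; rewrite (le_trans (ler_normD _ _))// lerD//.
by rewrite normrM ler_wpM2l.
Qed.

Lemma pair_norm1 h M x y : measurable_fun setT h -> (forall t, `|h t| <= M) ->
  `|pair h x - pair h y| <= M * norm1 (fun t => cls x t - cls y t).
Proof. by move=> mh hM; apply: integ01_close => //; exact: L1f_cls. Qed.

Lemma pair_bound h M x : measurable_fun setT h -> (forall t, `|h t| <= M) ->
  `|pair h x| <= M * `|x|.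
Proof.
move=> mh hM; have M0 : 0 <= M by exact: le_trans (hM 0).
have hf := L1fM (L1f_cls x) mh hM.
apply: le_trans (le_norm_integ01 hf) _.
apply: le_trans (norm1M (L1f_cls x) mh hM) _.
by rewrite ler_wpM2l// norm1_le.
Qed.

(** Truncating an element of the space of integrals changes its value at [x] as
    little as one likes, and the ideal property keeps it contractive. *)
Lemma norming_test x e : 0 < e -> exists2 h, test h & `|x| - e < pair h x.
Proof.
move=> e0; have e2 : 0 < e / 2 by rewrite divr_gt0.
have : ((`|x| - e / 2)%:E < dual2_norm cls (cls x))%E.
  by rewrite (ri_norming ri) lte_fin ltrBlDr ltrDl.
move=> /ereal_sup_gt[_ [g [[mg hg] ng] <-]].
have gi y : L1f (fun t => cls y t * g t).
  apply: hg; exists y; apply: representsI; first exact: measurable_cls.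
  exact: aeW.
have g1 y : `|y| <= 1 -> `|integ01 (fun t => cls y t * g t)| <= 1.
  move=> y1; rewrite -lee_fin (EFin_normr_Rintegral measurableT (gi y)).
  apply: le_trans ng; apply: ereal_sup_ubound; exists (cls y) => //.
  exists y => //; apply: representsI; first exact: measurable_cls.
  exact: aeW.
have gZ y : `|integ01 (fun t => cls y t * g t)| <= `|y|.
  have [->|y0] := eqVneq y 0.
    rewrite (_ : integ01 _ = 0) ?normr0//.
    rewrite -[RHS](integ01_cst 0); apply: integ01_ae => //; first exact: L1f_meas (gi 0).
    by apply: ae01S cls0 => t ->; rewrite mul0r.
  have ny : 0 < `|y| by rewrite normr_gt0.
  have := g1 (`|y|^-1 *: y); rewrite normrZ normfV normr_id mulVf ?gt_eqF// lexx.
  move=> /(_ isT).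
  rewrite (_ : integ01 _ = `|y|^-1 * integ01 (fun t => cls y t * g t)).
    by rewrite normrM normfV normr_id ler_pdivrMl// mulr1.
  rewrite -integ01Z//; apply: integ01_ae.
  - exact: L1f_meas (gi _).
  - exact: L1f_meas (L1fZ _ (gi _)).
  - by apply: ae01S (clsZ `|y|^-1 y) => t ->; rewrite mulrA.
rewrite (_ : (\int[mu]_t (g t * cls x t)%:E)%E = (\int[mu]_t (cls x t * g t)%:E)%E); last first.
  by apply: eq_integral => t _; rewrite mulrC.
rewrite -(EFin_normr_Rintegral measurableT (gi x)) lte_fin -/(integ01 _) => hx.
have [n hn] := truncate_cvg mg (gi x) e2.
have tt (s : R) : `|s| = 1 -> test (fun t => s * truncate n g t).
  move=> s1; have ms : measurable_fun setT (fun t => s * truncate n g t).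
    by apply: measurable_funM => //; exact: measurable_truncate.
  have bs t : `|s * truncate n g t| <= n%:R by rewrite normrM s1 mul1r truncate_le.
  split; first by split => //; exists n%:R.
  move=> z; pose A := [set t | `|g t| <= n%:R].
  have mA : measurable A by exact: measurable_truncate_set.
  have mz : measurable_fun setT (fun t => cls z t * \1_A t).
    by apply: measurable_funM; [exact: measurable_cls|exact: measurable_indic].
  have [|z' hz' nz'] := koethe_ideal ko (f := fun t => cls z t * \1_A t) (x := z) mz.
    apply: aeW => t; rewrite normrM ler_piMr//.
    exact: indic_bdd.
  have [_ {}hz'] := representsE hz'.
  apply: le_trans nz'; apply: le_trans (gZ z').
  rewrite -[leRHS]mul1r -s1 -normrM -integ01Z// le_eqVlt; apply/orP; left; apply/eqP.
  congr `|_|; apply: integ01_ae.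
  - apply: measurable_funM => //; exact: measurable_cls.
  - exact: L1f_meas (L1fZ _ (gi _)).
  - by apply: ae01S hz' => t ->; rewrite truncateE/=; ring.
have pE s : pair (fun t => s * truncate n g t) x =
    s * integ01 (fun t => cls x t * truncate n g t).
  have mt := measurable_truncate n mg.
  rewrite -integ01Z; last exact: L1fM (L1f_cls x) mt (truncate_le n g).
  by congr integ01; apply/funext => t; ring.
move: hn hx; set a := integ01 _; set b := integ01 _ => hn hx.
have [b0|b0] := leP 0 b.
  exists (fun t => 1 * truncate n g t); first by apply: tt; rewrite normr1.
  rewrite pE mul1r -/b.
  move: hx hn; rewrite ltr_norml => hx /andP[h1 h2].
  have : `|a| <= `|a - b| + `|b| by rewrite -{1}(subrK b a) ler_normD.
  rewrite (ger0_norm b0); have : `|a - b| < e / 2 by rewrite ltr_norml h1.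
  by lra.
exists (fun t => -1 * truncate n g t); first by apply: tt; rewrite normrN normr1.
rewrite pE -/b.
have : `|a| <= `|a - b| + `|b| by rewrite -{1}(subrK b a) ler_normD.
by rewrite (ltr0_norm b0); lra.
Qed.

(** The norm is a supremum of tests, which are continuous in the mean; hence
    balls are closed for convergence in the mean. *)
Lemma norm_lsc x c : (forall d, 0 < d -> exists2 y, `|y| <= c &
  norm1 (fun t => cls y t - cls x t) <= d) -> `|x| <= c.
Proof.
move=> hc; rewrite leNgt; apply/negP => cx.
pose e := (`|x| - c) / 2.
have e0 : 0 < e by rewrite divr_gt0// subr_gt0.
have [h [[mh [M hM]] th] hx] := norming_test x e0.
have M0 : 0 <= M by exact: le_trans (hM 0).
have d0 : 0 < e / (M + 1) by rewrite divr_gt0// ltr_wpDl.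
have [y yc yx] := hc _ d0.
have h1 := pair_norm1 y x mh hM.
have h2 : M * norm1 (fun t => cls y t - cls x t) < e.
  apply: le_lt_trans (ler_wpM2l M0 yx) _.
  rewrite mulrA ltr_pdivrMr ?ltr_wpDl// mulrC ltr_pM2l//.
  by rewrite ltrDl.
have h3 : pair h x - pair h y < e.
  by rewrite (le_lt_trans (ler_norm _))// distrC (le_lt_trans h1).
have h4 := le_trans (ler_norm _) (th y).
move: h3 h4 hx yc; rewrite /e; lra.
Qed.

End Space.

(** * Step functions as vectors: a symmetric norm *)

Section StepVectors.
Variables (R : realType) (X : completeNormedModType R) (cls : X -> L0 R).
Hypothesis ri : rearrangement_invariant cls.
Local Notation mu := (mu01 R).
Implicit Types (f g h : R -> R) (t : R) (x y z : X).

(** The vector of a step function, which is bounded and hence a member. *)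
Definition stepv N (v : 'I_N -> R) : X := elt cls (step v).

Lemma cls_stepv N (v : 'I_N -> R) : {ae mu, forall t, cls (stepv v) t = step v t}.
Proof. by case: (elt_bounded ri (measurable_step v) (step_bdd v)). Qed.

Lemma represents_stepv N (v : 'I_N -> R) : represents cls (stepv v) (step v).
Proof. exact: representsI (measurable_step v) (cls_stepv v). Qed.

Lemma stepv_eq N N' (v : 'I_N -> R) (w : 'I_N' -> R) :
  step v =1 step w -> stepv v = stepv w.
Proof. by move=> h; congr elt; apply/funext. Qed.

Lemma stepvD N (v w : 'I_N -> R) : stepv (fun i => v i + w i) = stepv v + stepv w.
Proof.
apply: (cls_inj ri); have h1 := cls_stepv v; have h2 := cls_stepv w.
have h3 := cls_stepv (fun i => v i + w i); have h4 := clsD ri (stepv v) (stepv w).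
have h5 := ae01S2 (fun t a b => conj a b) h1 h2.
have h6 := ae01S2 (fun t a b => conj a b) h3 h4.
by apply: (ae01S2 _ h5 h6) => t [a b] [c ->]; rewrite c stepD a b.
Qed.

Lemma stepvZ N c (v : 'I_N -> R) : stepv (fun i => c * v i) = c *: stepv v.
Proof.
apply: (cls_inj ri); have h1 := cls_stepv v.
have h3 := cls_stepv (fun i => c * v i); have h4 := clsZ ri c (stepv v).
have h6 := ae01S2 (fun t a b => conj a b) h3 h4.
by apply: (ae01S2 _ h1 h6) => t a [b ->]; rewrite b stepZ a.
Qed.

Lemma stepvB N (v w : 'I_N -> R) : stepv (fun i => v i - w i) = stepv v - stepv w.
Proof.
rewrite -scaleN1r -stepvZ -stepvD; congr stepv; apply/funext => i.
by rewrite mulN1r.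
Qed.

Lemma stepv_sum N I (r : seq I) (P : pred I) (F : I -> 'I_N -> R) :
  stepv (fun i => \sum_(j <- r | P j) F j i) = \sum_(j <- r | P j) stepv (F j).
Proof.
elim: r => [|j r IH].
  rewrite big_nil (_ : (fun i => _) = (fun i => 0 * 0)); first by rewrite stepvZ scale0r.
  by apply/funext => i; rewrite big_nil mul0r.
rewrite big_cons -IH; case: ifP => Pj.
  by rewrite -stepvD; congr stepv; apply/funext => i; rewrite big_cons Pj.
by congr stepv; apply/funext => i; rewrite big_cons Pj.
Qed.

Lemma stepv_mono N (v w : 'I_N -> R) : (forall i, `|v i| <= `|w i|) ->
  `|stepv v| <= `|stepv w|.
Proof.
move=> h; apply: (norm_mono ri).
apply: (ae01S2 _ (cls_stepv v) (cls_stepv w)) => t -> ->.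
by rewrite !step_norm; exact: le_step.
Qed.

Lemma stepv_perm N (s : {perm 'I_N}) (v : 'I_N -> R) :
  `|stepv (v \o s)| = `|stepv v|.
Proof.
have [tau [tauV [mpb _ tV]]] := exchange_mpb R s^-1%g.
apply/esym; apply: (ri_invariant_norm ri mpb (L1f_step v)); first exact: represents_stepv.
rewrite tV invgK (_ : _ \o _ = step (v \o s)); first exact: represents_stepv.
by apply/funext => t /=; rewrite step_exchange.
Qed.

Lemma stepv_blk L N K (eL : L = (N * K)%N) (v : 'I_N -> R) : (0 < K)%N -> (0 < N)%N ->
  stepv v = stepv (v \o blk eL).
Proof. by move=> K0 N0; apply: stepv_eq => t; exact: step_blk. Qed.

Lemma norm1_stepv N (v : 'I_N -> R) : (\sum_i `|v i|) / N%:R <= `|stepv v|.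
Proof.
rewrite -norm1_step; apply: le_trans (norm1_le ri _).
rewrite le_eqVlt; apply/orP; left; apply/eqP; apply: norm1_ae.
- exact: measurable_step.
- exact: measurable_cls.
- by apply: ae01S (cls_stepv v) => t ->.
Qed.

Lemma rearranged_member N (s : {perm 'I_N}) x : exists2 y,
  {ae mu, forall t, cls y t = cls x (exchange s t)} & `|y| = `|x|.
Proof.
have [tau [tauV [mpb _ tV]]] := exchange_mpb R s^-1%g.
have hx : represents cls x (cls x).
  by apply: representsI; [exact: measurable_cls|exact: aeW].
have mx : members cls (cls x) by exists x.
have [y hy] := (ri_invariant_mem ri mpb (L1f_cls ri x)).1 mx.
exists y; first by case: (representsE hy) => _; rewrite tV invgK.
exact/esym/(ri_invariant_norm ri mpb (L1f_cls ri x) hx hy).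
Qed.

(** Stated for a sum over a sequence of permutations, so that it can be proved by
    induction on the sequence; it is used for averages over a group. *)
Lemma sum_rearranged L (v : 'I_L -> R) x d (r : seq {perm 'I_L}) :
  norm1 (fun t => cls x t - step v t) <= d ->
  exists2 y, `|y| <= (size r)%:R * `|x| &
    norm1 (fun t => cls y t - step (fun i => \sum_(s <- r) v (s i)) t) <= (size r)%:R * d.
Proof.
move=> hd; elim: r => [|s r [y ny hy]].
  exists 0; first by rewrite normr0 mul0r.
  rewrite mul0r -[leRHS](integ01_cst 0) le_eqVlt; apply/orP; left; apply/eqP.
  apply: integ01_ae => //.
    apply: measurableT_comp => //; apply: L1f_meas; apply: L1fB; first exact: L1f_cls.
    exact: L1f_step.
  apply: ae01S (cls0 ri) => t ->.
  by rewrite /step big1 ?subr0 ?normr0// => i _; rewrite big_nil mul0r.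
have [z hz nz] := rearranged_member s x.
exists (z + y).
  by rewrite (le_trans (ler_normD _ _))// nz /= -natr1 mulrDl mul1r addrC lerD2r.
rewrite /= -natr1 mulrDl mul1r [leRHS]addrC.
pose f t := cls x t - step v t.
have lf : L1f f by apply: L1fB; [exact: L1f_cls|exact: L1f_step].
pose g t := cls y t - step (fun i => \sum_(s <- r) v (s i)) t.
have lg : L1f g by apply: L1fB; [exact: L1f_cls|exact: L1f_step].
have lfs := L1f_exchange s lf.
apply: (@le_trans _ _ (norm1 (fun t => (f \o exchange s) t + g t))).
  rewrite le_eqVlt; apply/orP; left; apply/eqP; apply: norm1_ae.
  - by apply: L1f_meas; apply: L1fB; [exact: L1f_cls|exact: L1f_step].
  - by apply: L1f_meas; exact: L1fD.
  - apply: (ae01S2 _ hz (clsD ri z y)) => t h1 ->; rewrite h1 /f /g /= step_exchange.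
    rewrite (_ : step _ t = step (v \o s) t + step (fun i => \sum_(s <- r) v (s i)) t).
      by ring.
    by rewrite -stepD; congr step; apply/funext => i; rewrite big_cons.
apply: le_trans (norm1D lfs lg) _; rewrite lerD//.
by rewrite norm1_exchange.
Qed.

(** Averaging over cells is, in the mean, a limit of averages of rearrangements
    that permute ever smaller pieces inside each cell; so it is contractive. *)
Lemma avg_norm N x : (0 < N)%N -> `|stepv (mean (cls x) : 'I_N -> R)| <= `|x|.
Proof.
move=> N0; apply: (norm_lsc ri) => d d0; have d2 : 0 < d / 2 by rewrite divr_gt0.
have [K K0 hK] := step_dense (L1f_cls ri x) d2.
pose L := (N * K)%N; have eL : L = (N * K)%N by [].
have [|v /ltW hv] := hK L; first by rewrite /L leq_pmull.
pose G := fibre_perms (blk eL).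
have [y ny hy] := sum_rearranged (enum G) hv.
have G0 : 0 < #|G|%:R :> R by rewrite ltr0n card_fibre_perms_gt0.
rewrite -cardE in ny hy.
exists (#|G|%:R^-1 *: y).
  by rewrite normrZ gtr0_norm ?invr_gt0// ler_pdivrMl.
have lx := L1f_cls ri x.
have lv := L1f_step v.
have la : L1f (avg N (step v)) by exact: L1f_step.
have lm : L1f (avg N (cls x)) by exact: L1f_step.
pose w := (fun i : 'I_L => \sum_(s <- enum G) v (s i)).
have aE t : avg N (step v) t = #|G|%:R^-1 * step w t.
  rewrite (avg_step_blk eL K0 N0) -/G; congr (_ * _).
  rewrite -big_enum/=; under eq_bigr do rewrite step_exchange.
  rewrite /step exchange_big/=; apply: eq_bigr => i _.
  by rewrite /w mulr_suml.
have lw : L1f (step w) by exact: L1f_step.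
have lyw := L1fB (L1f_cls ri y) lw; have lZ := L1fZ #|G|%:R^-1 lyw.
have lva := L1fB la lm.
apply: (@le_trans _ _ (norm1 (fun t => #|G|%:R^-1 * (cls y t - step w t)
   + (avg N (step v) t - avg N (cls x) t)))).
  rewrite le_eqVlt; apply/orP; left; apply/eqP; apply: norm1_ae.
  - by apply: L1f_meas; apply: L1fB; exact: L1f_cls.
  - by apply: L1f_meas; exact: L1fD.
  - apply: (ae01S2 _ (clsZ ri #|G|%:R^-1 y) (@cls_stepv N (mean (cls x)))) => t -> ->.
    by rewrite aE /avg; ring.
apply: le_trans (norm1D lZ lva) _; rewrite (splitr d) lerD//.
  by rewrite norm1Z// gtr0_norm ?invr_gt0// ler_pdivrMl.
apply: le_trans hv; rewrite (norm1C (cls x)).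
exact: avg_contract.
Qed.

Definition ind N (A : {set 'I_N}) (i : 'I_N) : R := (i \in A)%:R.
(** The fundamental function of the space, on unions of cells. *)
Definition setnorm N (A : {set 'I_N}) : R := `|stepv (ind A)|.

Lemma ind_norm N (A : {set 'I_N}) i : `|ind A i| = ind A i.
Proof. by rewrite /ind normr_nat. Qed.

(** The norm of an indicator is monotone and does not change when cells are
    permuted. *)
Lemma setnorm_card N (A B : {set 'I_N}) : (#|A| <= #|B|)%N -> setnorm A <= setnorm B.
Proof.
move=> AB; have [C CB cC] := subset_of_card AB.
have [s hs] := perm_of_card (esym cC).
rewrite /setnorm (_ : ind A = ind C \o s); last first.
  by apply/funext => i; rewrite /ind /= hs.
rewrite stepv_perm; apply: stepv_mono => i; rewrite !ind_norm /ind ler_nat.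
by have := fintype.subsetP CB i; case: (i \in C) => // ->.
Qed.

Lemma setnorm_T N : (0 < N)%N -> setnorm [set: 'I_N]%SET = 1.
Proof.
move=> N0; apply/eqP; rewrite eq_le; apply/andP; split.
  have [||_] := @elt_bounded _ _ _ ri (step (ind [set: 'I_N]%SET)) 1 => //.
    exact: measurable_step.
  move=> t; apply: (@cell_case _ N (fun t => `|step (ind [set: 'I_N]%SET) t| <= 1)) => //.
    by move=> ht; rewrite step_out// normr0.
  by move=> i it; rewrite (step_at _ it) ind_norm /ind inE.
apply: le_trans (norm1_stepv (ind _)).
rewrite (eq_bigr (fun=> 1)); last by move=> i _; rewrite ind_norm /ind inE.
by rewrite sumr_const card_ord divff// pnatr_eq0 -lt0n.
Qed.

Lemma setnorm_blk L N K (eL : L = (N * K)%N) (A : {set 'I_N}) : (0 < K)%N -> (0 < N)%N ->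
  setnorm [set l | blk eL l \in A]%SET = setnorm A.
Proof.
move=> K0 N0; rewrite /setnorm (stepv_blk eL (ind A))//; congr (`|stepv _|).
by apply/funext => l; rewrite /ind inE.
Qed.

Lemma setnormU N (A B : {set 'I_N}) : setnorm (A :|: B)%SET <= setnorm A + setnorm B.
Proof.
rewrite /setnorm; apply: le_trans (ler_normD _ _); rewrite -stepvD.
apply: stepv_mono => i; rewrite ind_norm ger0_norm ?addr_ge0 ?ler0n// /ind inE.
by rewrite -natrD ler_nat; case: (i \in A); case: (i \in B).
Qed.

(** The average of [v] over the permutations that preserve [A] has norm at most
    that of [v], and it is constant on [A]. *)
Lemma setnorm_mean N (A : {set 'I_N}) (v : 'I_N -> R) :
  `|\sum_(i in A) v i| * setnorm A <= #|A|%:R * `|stepv v|.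
Proof.
have [->|A0] := eqVneq A finset.set0.
  by rewrite big_set0 normr0 mul0r cards0 mul0r.
pose G := fibre_perms (fun i => i \in A).
have G0 : 0 < #|G|%:R :> R by rewrite ltr0n card_fibre_perms_gt0.
have cA : 0 < #|A|%:R :> R by rewrite ltr0n card_gt0.
rewrite -(ler_pM2l G0).
pose w i := \sum_(s in G) v (s i).
have wE i : i \in A -> w i * #|A|%:R = #|G|%:R * \sum_(i in A) v i.
  move=> iA; have := fibre_perms_avg (fun i => i \in A) v i.
  rewrite (eq_bigl (fun i => i \in A)) ?sumr_const; last first.
    by move=> j; rewrite iA eqb_id.
  move=> ->; congr (_ * _); apply: eq_bigl => j.
  by rewrite iA eqb_id.
have wn : `|stepv w| <= #|G|%:R * `|stepv v|.
  rewrite /w stepv_sum (le_trans (ler_norm_sum _ _ _))//.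
  rewrite mulr_natl -sumr_const; apply: ler_sum => s _.
  by rewrite (stepv_perm s v).
apply: (@le_trans _ _ (#|A|%:R * `|stepv w|)); last first.
  by rewrite mulrCA ler_pM2l.
have a0 : 0 <= #|G|%:R * `|\sum_(i in A) v i| by rewrite mulr_ge0 ?ler0n.
rewrite mulrA /setnorm -{1}(ger0_norm a0) -normrZ.
rewrite -{1}(ger0_norm (ltW cA)) -normrZ -!stepvZ.
apply: stepv_mono => i; rewrite /ind; have [iA|iA] := boolP (i \in A); last first.
  by rewrite mulr0 normr0.
by rewrite mulr1 [in leRHS]mulrC wE// !normrM normr_id.
Qed.

End StepVectors.

(** * Slices of the unit ball under the Daugavet property *)

Section Slices.
Variables (R : realType) (X : completeNormedModType R) (cls : X -> L0 R).
Hypothesis ri : rearrangement_invariant cls.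
Hypothesis dp : daugavet_property X.
Local Notation mu := (mu01 R).
Implicit Types (f g h : R -> R) (t : R) (x y z : X).
Local Notation pair := (pair cls).
Local Notation test := (test cls).

(** This is the norm equation for the rank-one operator [x |-> pair H x *: x0],
    with [C] the norm of the functional [pair H]. *)
Lemma daugavet_pair H y0 x0 : bounded_fun H -> `|y0| <= 1 -> 0 < pair H y0 ->
  `|x0| = 1 -> exists C : R,
  (forall z, `|z| <= 1 -> `|pair H z| <= C) /\
  forall d, 0 < d -> exists2 y, `|y| <= 1 & 1 + C - d < `|y + pair H y *: x0|.
Proof.
move=> bH y01 py0 nx0.
pose T0 := fun x : X => pair H x *: x0.
have linT : linear T0.
  by move=> a x y; rewrite /T0 (pairDZ ri)// scalerDl scalerA.
pose T : {linear X -> X} := HB.pack T0 (GRing.isLinear.Build R X X _ T0 linT).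
have x0n : x0 != 0 by rewrite -normr_gt0 nx0.
have [mH [M hM]] := bH.
have nT x : `|T x| = `|pair H x| by rewrite /T/= normrZ nx0 mulr1.
have cT : continuous T.
  apply: bounded_linear_continuous; apply/linear_boundedP.
  exists M; split; first by rewrite num_real.
  move=> r Mr x; rewrite nT (le_trans (pair_bound ri x mH hM))//.
  by rewrite ler_wpM2r// ltW.
have rT : rank_one T.
  exists x0 => //; apply/seteqP; split.
    by move=> _ [x _ <-]; exists (pair H x).
  move=> _ [a _ <-]; exists ((a / pair H y0) *: y0) => //.
  by rewrite /T /= /T0 (pairZ ri)// divfK// gt_eqF.
have ub z : `|z| <= 1 -> (`|pair H z|%:E <= opnorm T)%E.
  by move=> z1; apply: ereal_sup_ubound; exists z => //; rewrite nT.
have fT : opnorm T \is a fin_num.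
  rewrite fin_numElt; apply/andP; split.
    by rewrite (lt_le_trans _ (ub _ y01))// ltNyr.
  apply: (@le_lt_trans _ _ M%:E); last by rewrite ltry.
  apply: ge_ereal_sup => _ [x /= x1 <-]; rewrite lee_fin nT.
  have M0 : 0 <= M by exact: le_trans (hM 0).
  rewrite (le_trans (pair_bound ri x mH hM))// -[leRHS]mulr1.
  by rewrite ler_wpM2l.
exists (fine (opnorm T)).
split=> [z z1|d d0].
  by have := ub z z1; rewrite -{1}(fineK fT) lee_fin.
have := dp cT rT; rewrite -(fineK fT) => dT.
have : ((1 + fine (opnorm T) - d)%:E < opnorm (fun x => (x + T x)%R))%E.
  by rewrite dT lte_fin ltrBlDr ltrDl.
by move=> /ereal_sup_gt[_ [y /= y1 <-]]; rewrite lte_fin; exists y.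
Qed.

(** The norm equation yields one vector [y] of the slice that adds up with [x0]
    almost without cancellation. To pass from [y] to a whole slice, add to
    [pair H] a multiple of a test [h] that almost norms the sum: where the new
    functional is almost maximal, so are both summands, and [h] is large at the
    vector as well as at [x0]. *)
Lemma slice_step H c y0 x0 e : bounded_fun H -> 0 <= c -> `|y0| <= 1 ->
  c < pair H y0 -> `|x0| = 1 -> 0 < e ->
  exists H' c' y', [/\ bounded_fun H', 0 <= c', `|y'| <= 1, c' < pair H' y' &
    forall z, `|z| <= 1 -> c' < pair H' z -> c < pair H z /\ 2 - e < `|z + x0|].
Proof.
move=> bH c0 y01 cy0 nx0 e0.
have p0 : 0 < pair H y0 by exact: le_lt_trans cy0.
have [C [ubC nC]] := daugavet_pair bH y01 p0 nx0.
have cC : c < C by apply: lt_le_trans cy0 (le_trans (ler_norm _) (ubC _ y01)).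
have C0 : 0 < C by exact: le_lt_trans cC.
pose d := Num.min ((C - c) / (1 + C)) (e * C / (2 + C)).
have d0 : 0 < d.
  by rewrite lt_min !divr_gt0 ?mulr_gt0 ?subr_gt0 ?addr_gt0.
have d1 : d * (1 + C) <= C - c.
  by rewrite -ler_pdivlMr ?addr_gt0// ge_min lexx.
have d2 : d * (2 + C) <= e * C.
  by rewrite -ler_pdivlMr ?addr_gt0// ge_min lexx orbT.
clearbody d.
have [y1 y11 hy1] := nC d d0.
have [y [ny a0 hy]] : exists y, [/\ `|y| <= 1, 0 <= pair H y &
    1 + C - d < `|y + pair H y *: x0|].
  have [h|h] := leP 0 (pair H y1); first by exists y1.
  exists (- y1); rewrite normrN (pairN ri)// oppr_ge0; split => //; first exact: ltW.
  by rewrite scaleNr -opprD normrN.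
set a := pair H y in a0 hy.
have aC : a <= C by exact: le_trans (ler_norm _) (ubC y ny).
set n := `|y + a *: x0| in hy.
have n0 : 0 < n - (1 + C - d) by rewrite subr_gt0.
have [h [bh th] hh] := norming_test ri (y + a *: x0) n0.
have {}hh : 1 + C - d < pair h y + a * pair h x0.
  by move: hh; rewrite (pairD ri)// (pairZ ri)// -/n; lra.
have py1 : pair h y <= 1 by rewrite (le_trans (ler_norm _))// (le_trans (th y)).
have px1 : pair h x0 <= 1 by rewrite (le_trans (ler_norm _))// (le_trans (th x0))// nx0.
have dC0 : 0 <= d * C by rewrite mulr_ge0// ltW.
have ax : a * pair h x0 <= a by rewrite ler_piMr.
have Cx : C - d < C * pair h x0.
  have h1 : C - d < a * pair h x0 by lra.
  apply: lt_le_trans h1 _; rewrite ler_wpM2r//.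
  have ap : 0 < a by lra.
  by rewrite -(pmulr_rge0 _ ap); lra.
have Cy : C - C * d < C * pair h y.
  by rewrite -[X in X - _]mulr1 -mulrBr ltr_pM2l//; lra.
exists (fun t => H t + C * h t), (2 * C - d - C * d), y; split => //.
- exact: bounded_comb.
- by lra.
- by rewrite (pair_comb ri)// -/a; lra.
move=> z z1; rewrite (pair_comb ri)// => hz.
have zC := le_trans (ler_norm _) (ubC z z1).
have pz : pair h z <= 1 by rewrite (le_trans (ler_norm _))// (le_trans (th z)).
have Cz : C * pair h z <= C by rewrite -[leRHS]mulr1 ler_pM2l.
split; first by lra.
apply: lt_le_trans (th _); apply: lt_le_trans (ler_norm _).
rewrite (pairD ri)// -(ltr_pM2l C0) mulrDr; lra.
Qed.

(** Starting with the slice of the integral itself, refine it once for each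
    given vector. *)
Lemma slices e (xs : seq X) : 0 < e -> e < 1 -> (forall x, x \in xs -> `|x| = 1) ->
  exists H c y, [/\ bounded_fun H, `|y| <= 1, c < pair H y &
    forall z, `|z| <= 1 -> c < pair H z ->
      1 - e < pair (fun=> 1) z /\ forall x, x \in xs -> 2 - e < `|z + x|].
Proof.
move=> e0 e1 nxs.
suff [H [c [y [bH _ ny cy h]]]] : exists H c y, [/\ bounded_fun H, 0 <= c,
    `|y| <= 1, c < pair H y & forall z, `|z| <= 1 -> c < pair H z ->
      1 - e < pair (fun=> 1) z /\ forall x, x \in xs -> 2 - e < `|z + x|].
  by exists H, c, y.
elim: xs nxs => [|x xs IH] nxs.
  have m1 : measurable_fun setT (fun _ : R => 1 : R) by exact: measurable_cst.
  have b1 t : `|(fun _ : R => 1 : R) t| <= 1 by rewrite normr1.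
  have [h1 n1] := elt_bounded ri m1 b1.
  exists (fun=> 1), (1 - e), (elt cls (fun=> 1)); split => //.
  - by split => //; exists 1.
  - by rewrite subr_ge0 ltW.
  - rewrite (_ : pair _ _ = 1); first by rewrite ltrBlDr ltrDl.
    rewrite -[RHS](integ01_cst 1); apply: integ01_ae => //.
      by apply: measurable_funM => //; exact: measurable_cls.
    by apply: ae01S h1 => t ->; rewrite mulr1.
have [|H [c [y [bH c0 ny cy h]]]] := IH; first by move=> z zx; apply: nxs; rewrite inE zx orbT.
have nx : `|x| = 1 by apply: nxs; rewrite inE eqxx.
have [H' [c' [y' [bH' c0' ny' cy' h']]]] := slice_step bH c0 ny cy nx e0.
exists H', c', y'; split => // z z1 hz; have [hz1 hz2] := h' z z1 hz.
have [hz3 hz4] := h z z1 hz1; split => // x'.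
by rewrite inE => /predU1P[->//|]; exact: hz4.
Qed.

End Slices.

(** * Small cells in a separable space *)

Section Separable.
Variables (R : realType) (X : completeNormedModType R) (cls : X -> L0 R).
Hypothesis ri : rearrangement_invariant cls.
Local Notation mu := (mu01 R).
Local Notation setnorm := (setnorm cls).

(** If small cells all had norm one, the indicators of the intervals [0, t]
    would be uncountably many vectors at mutual distance at least one. *)
Lemma separable_small_cell : separable X ->
  exists q, setnorm [set (ord0 : 'I_q.+1)]%SET < 1.
Proof.
move=> [D cD dD]; apply: contrapT => /forallNP hq.
have {}hq q : 1 <= setnorm [set (ord0 : 'I_q.+1)]%SET.
  by rewrite leNgt; apply/negP; exact: hq.
pose u (t : R) : X := elt cls (\1_(`[0, t]%classic : set R) : R -> R).
have uE t : {ae mu, forall r, cls (u t) r = \1_(`[0, t]%classic : set R) r}.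
  have mA : measurable (`[0, t]%classic : set R) by exact: measurable_itv.
  by case: (elt_bounded ri (measurable_indic mA) (@indic_bdd R _)).
have sep t t' : 0 <= t -> t < t' -> t' <= 1 -> 1 <= `|u t' - u t|.
  (* [N] is so large that a whole cell fits between [t] and [t'] *)
  move=> t0 tt' t1; pose q := Num.trunc (2 / (t' - t)); pose N := q.+1.
  have N0 : (0 : R) < N%:R by rewrite ltr0n.
  have qN : 2 < (t' - t) * N%:R.
    by rewrite -ltr_pdivrMl ?subr_gt0// mulrC truncnS_gt.
  have /andP[h1 h2] : (Num.trunc (t * N%:R))%:R <= t * N%:R < (Num.trunc (t * N%:R)).+1%:R.
    by apply: truncn_itv; rewrite mulr_ge0// ltW.
  set i := (Num.trunc (t * N%:R)).+1 in h2.
  have {}h1 : i.+1%:R < t' * N%:R.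
    by move: h1 qN; rewrite /i -!natr1 mulrBl; lra.
  have iN : (i < N)%N.
    rewrite -(ltr_nat R); apply: lt_le_trans (_ : i.+1%:R <= N%:R); first by rewrite ltr_nat.
    by rewrite (le_trans (ltW h1))// ler_piMl// ltW.
  have cl := cls_stepv ri (ind R [set Ordinal iN]%SET).
  apply: le_trans (hq q) _.
  apply: (@le_trans _ _ (setnorm [set Ordinal iN]%SET)).
    by apply: (setnorm_card ri); rewrite !cards1.
  apply: (norm_mono ri).
  have h3 := ae01S2 (fun t a b => conj a b) (uE t') (uE t).
  have h4 := ae01S2 (fun t a b => conj a b) cl (clsB ri (u t') (u t)).
  apply: (ae01S2 _ h3 h4) => r [e1 e2] [-> ->]; rewrite e1 e2 step_norm.
  apply: (@cell_case R N (fun r => step (fun i0 => `|ind R [set Ordinal iN]%SET i0|) r <=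
    `|\1_(`[0, t']%classic : set R) r - \1_(`[0, t]%classic : set R) r|)) => //.
    by move=> hr; rewrite step_out.
  move=> j jr; rewrite (step_at _ jr) ind_norm /ind inE; case: eqP => [ej|_]; last exact: normr_ge0.
  move: jr; rewrite ej => /(@cellE R N _ _ (ltn0Sn _))/andP[r1 r2].
  have tr : t < r by rewrite -(ltr_pM2r N0) (lt_le_trans h2).
  have rt : r <= t' by rewrite ltW// -(ltr_pM2r N0) (lt_trans r2).
  have r0 : 0 <= r by rewrite (le_trans t0)// ltW.
  have i1 : r \in (`[0, t']%classic : set R) by rewrite inE/= in_itv/= r0.
  have i2 : r \in (`[0, t]%classic : set R) = false.
    by apply/negbTE; rewrite notin_setE/= in_itv/= r0/= leNgt tr.
  by rewrite !indicE i1 i2 subr0 normr1.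
have near_D t : exists d, D d /\ `|u t - d| < 1 / 2.
  have [|d [Bd Dd]] := dD (ball (u t) (1 / 2)) _ (ball_open _ _).
    by exists (u t); apply: ballxx; rewrite divr_gt0.
  by exists d; split => //; move: Bd; rewrite -ball_normE.
have [d hd] := choice near_D.
have /countable_injP[f finj] := cD.
have c01 : countable (`[0, 1]%classic : set R).
  apply/countable_injP; exists (f \o d) => s t /set_mem hs /set_mem ht /= fst.
  have dst : d s = d t by apply: finj => //; apply/mem_set; case: (hd s); case: (hd t).
  have lt1 : `|u s - u t| < 1.
    rewrite (le_lt_trans (ler_distD (d s) _ _))// [X in _ < X](splitr 1) ltrD//.
      by case: (hd s).
    by rewrite dst distrC; case: (hd t).
  move: hs ht; rewrite /= !in_itv/= => /andP[s0 s1] /andP[t0 t1].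
  case: (ltgtP s t) => // st.
    by have := sep _ _ s0 st t1; rewrite distrC leNgt lt1.
  by have := sep _ _ t0 st s1; rewrite leNgt lt1.
have := countable_lebesgue_measure0 c01.
rewrite lebesgue_measure_itv/= lte01 oppr0 adde0 => /eqP.
by rewrite eqe oner_eq0.
Qed.

End Separable.

(** * Concentration on small sets *)

Section Concentration.
Variables (R : realType) (X : completeNormedModType R) (cls : X -> L0 R).
Hypothesis ri : rearrangement_invariant cls.
Local Notation mu := (mu01 R).
Local Notation setnorm := (setnorm cls).
Local Notation stepv := (stepv cls).
Local Notation pair := (pair cls).
Implicit Types (x y z : X).

Lemma pair1_stepv N (v : 'I_N -> R) : pair (fun=> 1) (stepv v) = (\sum_i v i) / N%:R.
Proof.
rewrite -integ01_step; apply: integ01_ae; last first.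
- by apply: ae01S (cls_stepv ri v) => t ->; rewrite mulr1.
- exact: measurable_step.
- by apply: measurable_funM => //; exact: measurable_cls.
Qed.

(** Averages over cells converge in the mean, and [pair h] is continuous for that
    convergence. *)
Lemma avg_in_slice h c y : bounded_fun h -> c < pair h y -> exists N0, forall N,
  (N0 <= N)%N -> c < pair h (stepv (mean (cls y) : 'I_N -> R)).
Proof.
move=> [mh [M hM]] hy; have M0 : 0 <= M by exact: le_trans (hM 0).
have M1 : 0 < M + 1 by rewrite ltr_wpDl.
have d0 : 0 < (pair h y - c) / (M + 1) by rewrite divr_gt0 ?subr_gt0.
have [N0 _ hN0] := avg_cvg (L1f_cls ri y) d0; exists N0 => N /hN0.
rewrite ltr_pdivlMr// => hN.
have := pair_norm1 ri (stepv (mean (cls y) : 'I_N -> R)) y mh hM.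
rewrite distrC => /(le_trans (ler_norm _)).
rewrite (_ : norm1 _ = norm1 (fun t => cls y t - avg N (cls y) t)).
  have := norm1_ge0 (fun t => cls y t - avg N (cls y) t).
  by move: hN; set a := norm1 _; rewrite mulrDr mulr1 mulrC; lra.
rewrite norm1C; apply: norm1_ae.
- by apply: L1f_meas; apply: L1fB; exact: L1f_cls.
- by apply: L1f_meas; apply: L1fB; [exact: L1f_cls|exact: L1f_step].
- by apply: ae01S (cls_stepv ri (mean (cls y) : 'I_N -> R)) => t ->.
Qed.

(** Where [s] exceeds [e] on [A], subtracting the indicator of [A] cancels at
    least [e]: there [`|s - 1| <= `|s| + 1 - e]. *)
Lemma stepv_sub_ind N (s : 'I_N -> R) (A : {set 'I_N}) e : 0 < e <= 1 ->
  `|stepv s - stepv (ind R A)| <=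
  `|stepv s| + (1 - e) * setnorm A + e * setnorm (A :\: [set l | e < s l])%SET.
Proof.
move=> /andP[e0 e1]; rewrite -(stepvB ri).
set B := [set l | e < s l]%SET.
have -> : e * setnorm (A :\: B)%SET = `|stepv (fun i => e * ind R (A :\: B)%SET i)|.
  by rewrite (stepvZ ri) normrZ gtr0_norm.
have -> : (1 - e) * setnorm A = `|stepv (fun i => (1 - e) * ind R A i)|.
  by rewrite (stepvZ ri) normrZ ger0_norm// subr_ge0.
have -> : `|stepv s| = `|stepv (fun i => `|s i|)|.
  by apply/eqP; rewrite eq_le; apply/andP; split; apply: (stepv_mono ri) => i;
    rewrite normr_id.
rewrite (le_trans _ (lerD (ler_normD _ _) (lexx _)))// -!(stepvD ri).
rewrite (le_trans _ (ler_normD _ _))// -!(stepvD ri).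
apply: (stepv_mono ri) => i; apply: le_trans (ler_norm _).
rewrite /ind !inE; case: (i \in A); rewrite /= ?andbF ?mulr0 ?subr0 ?addr0//.
rewrite andbT mulr1; case: ltP => h /=; rewrite ?mulr0 ?mulr1 ?addr0.
  rewrite (ger0_norm (le_trans (ltW e0) (ltW h))) ler_norml; apply/andP; split; lra.
by rewrite (le_trans (ler_normB _ _))// normr1; lra.
Qed.

Hypothesis dp : daugavet_property X.
Variable q : nat.
Hypothesis hq : setnorm [set (ord0 : 'I_q.+1)]%SET < 1.

(** Let [j] be the least number of cells, out of [n], whose indicator has norm
    one; as [setnorm A1 < 1] for [j - 1] cells, a step function [s] that does not
    cancel with the indicator of [j] cells can exceed [e] only on less than one
    [n]-th of the interval inside them. A slice provides an [s] with integral
    almost one that cancels with none of these indicators. Since [j > M] while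
    the interval consists of [q + 1] blocks of [M] cells, the set [B] where [s]
    exceeds [e] is small, yet it carries almost the whole integral; averaging
    [s] over [B] bounds the norm of the indicator of [B]. *)
Lemma small_set M e : (0 < M)%N -> 0 < e -> e < 1 / 2 ->
  exists N (B : {set 'I_N}), [/\ (0 < N)%N, (0 < #|B|)%N, (#|B| * M <= N)%N &
    setnorm B * (1 - 2 * e) <= #|B|%:R / N%:R].
Proof.
move=> M0 e0 e2; pose n := (q.+1 * M)%N; have en : n = (q.+1 * M)%N by [].
have n0 : (0 < n)%N by rewrite muln_gt0.
pose A0 := [set l | blk en l \in [set (ord0 : 'I_q.+1)]]%SET.
have cA0 : #|A0| = M by rewrite (card_blk R) // cards1 muln1.
have nA0 : setnorm A0 < 1 by rewrite setnorm_blk.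
have nT : setnorm [set: 'I_n]%SET = 1 by exact: (setnorm_T ri).
have n1 (A : {set 'I_n}) : setnorm A <= 1.
  by rewrite -nT; apply: (setnorm_card ri); rewrite cardsT; exact: max_card.
pose P j := [exists A : {set 'I_n}, (#|A| == j) && (1 <= setnorm A)].
have exP : exists j, P j.
  by exists #|[set: 'I_n]%SET|; apply/existsP; exists [set: 'I_n]%SET; rewrite eqxx nT lexx.
have [j /existsP[As /andP[/eqP cAs nAs]] jmin] := ex_minnP exP.
have Mj : (M < j)%N.
  rewrite ltnNge; apply/negP => jM.
  have : setnorm As <= setnorm A0 by apply: (setnorm_card ri); rewrite cAs cA0.
  by rewrite leNgt (lt_le_trans nA0).
have jn : (j <= n)%N by rewrite -cAs -[X in (_ <= X)%N]card_ord max_card.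
have nj (A : {set 'I_n}) : #|A| = j -> setnorm A = 1.
  move=> cA; apply/eqP; rewrite eq_le n1/= (le_trans nAs)//.
  by apply: (setnorm_card ri); rewrite cAs cA.
have [A1 _ cA1] : exists2 A1 : {set 'I_n}, A1 \subset As & #|A1| = j.-1.
  by apply: subset_of_card; rewrite cAs leq_pred.
have nA1 : setnorm A1 < 1.
  rewrite ltNge; apply/negP => h.
  have : P j.-1 by apply/existsP; exists A1; rewrite cA1 eqxx h.
  by move=> /jmin; rewrite leqNgt prednK ?leqnn//; exact: leq_trans Mj.
pose g := 1 - setnorm A1; have g0 : 0 < g by rewrite subr_gt0.
have g1 : g <= 1 by rewrite /g lerBlDr lerDl normr_ge0.
pose d := e * g; have d0 : 0 < d by rewrite mulr_gt0.
have de : d <= e by rewrite ler_piMr// ltW.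
have d1 : d < 1 by lra.
(* the slice must serve all sets of [j] cells: which ones meet [B] a lot is
   known only later *)
pose xs := [seq - stepv (ind R A) | A <- enum [set A : {set 'I_n} | #|A| == j]%SET].
have xs1 x : x \in xs -> `|x| = 1.
  move=> /mapP[A]; rewrite mem_enum inE => /eqP cA ->.
  by rewrite normrN; exact: nj.
have [h [c [y [bh ny cy hz]]]] := slices ri dp d0 d1 xs1.
have [N0 hN0] := avg_in_slice bh cy.
pose K := N0.+1; pose N := (n * K)%N; have eN : N = (n * K)%N by [].
have N_gt0 : (0 < N)%N by rewrite muln_gt0 n0.
pose s : 'I_N -> R := mean (cls y).
have cs : c < pair h (stepv s).
  by apply: hN0; apply: leq_trans (leqnSn _) _; rewrite /N leq_pmull.
have ns : `|stepv s| <= 1 by apply: le_trans ny; exact: (avg_norm ri).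
have [hs1 hs2] := hz _ ns cs.
pose B := [set l | e < s l]%SET.
(* otherwise [A' :\: B] has at most as many cells as [A1] has at this level *)
have hB (A : {set 'I_n}) : #|A| = j ->
    (#|[set l | blk eN l \in A]%SET :&: B| < K)%N.
  move=> cA; rewrite ltnNge; apply/negP => hK.
  set A' := [set l | _]%SET in hK.
  have cA' : #|A'| = (K * j)%N by rewrite (card_blk R)// cA.
  have hAx : - stepv (ind R A) \in xs.
    by apply/mapP; exists A; rewrite // mem_enum inE cA.
  have := hs2 _ hAx; apply/negP; rewrite -leNgt.
  have -> : stepv (ind R A) = stepv (ind R A').
    rewrite (stepv_blk cls eN (ind R A))//; congr stepv.
    by apply/funext => l; rewrite /ind /= inE.
  have e01 : 0 < e <= 1 by lra.
  apply: le_trans (stepv_sub_ind s A' e01) _.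
  have -> : setnorm A' = 1 by rewrite setnorm_blk// nj.
  have : setnorm (A' :\: B)%SET <= setnorm A1.
    rewrite -(setnorm_blk cls eN A1)//; apply: (setnorm_card ri).
    rewrite (card_blk R)// cA1 cardsD cA'.
    by rewrite -subn1 mulnBr muln1 leq_sub2l.
  rewrite -(ler_pM2l e0); move: ns; rewrite -/B /d /g mulrBr; lra.
have cB : (#|B| <= q.+1 * K)%N.
  pose f l := blk en (blk eN l).
  rewrite -sum1_card (partition_big f predT)//=.
  rewrite -[X in (_ <= X * _)%N]card_ord -sum_nat_const; apply: leq_sum => i _.
  have [||A iA cA] := @superset_of_card n [set l | blk en l \in [set i]]%SET j.
  - by rewrite (card_blk R)// cards1 muln1 ltnW.
  - exact: jn.
  rewrite sum1_card; apply: leq_trans (ltnW (hB A cA)); apply: subset_leq_card.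
  apply/fintype.subsetP => l /andP[lB /eqP fl].
  rewrite inE lB andbT inE; apply: (fintype.subsetP iA).
  by rewrite !inE -fl.
have NR : 0 < N%:R :> R by rewrite ltr0n.
(* off [B] the values of [s] are at most [e], so the integral over [B] is
   more than [1 - d - e] *)
have sB : N%:R * (1 - 2 * e) < \sum_(l in B) s l.
  have : \sum_l s l <= \sum_(l in B) s l + N%:R * e.
    rewrite (bigID (fun l => l \in B))/= lerD2l.
    apply: (@le_trans _ _ (\sum_(l < N | l \notin B) e)).
      by apply: ler_sum => l; rewrite inE -leNgt.
    rewrite sumr_const -[leLHS]mulr_natl ler_wpM2r ?(ltW e0)// ler_nat.
    by rewrite -[X in (_ <= X)%N]card_ord max_card.
  move: hs1; rewrite pair1_stepv ltr_pdivlMr// => hs1 hs3.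
  have : N%:R * d <= N%:R * e by rewrite ler_pM2l.
  by move: hs1; rewrite mulrBl mul1r (mulrC d); lra.
have s0 : 0 <= N%:R * (1 - 2 * e) by rewrite mulr_ge0// subr_ge0; lra.
exists N, B; split => //.
- rewrite card_gt0; apply: contraTneq sB => ->.
  by rewrite big_set0 -leNgt.
- apply: (@leq_trans (q.+1 * K * M)); first by rewrite leq_mul2r cB orbT.
  by rewrite mulnAC.
have := setnorm_mean ri B s; rewrite ger0_norm; last exact: le_trans (ltW sB).
move=> /le_trans-/(_ #|B|%:R); rewrite ler_piMr// => /(_ isT) hm.
rewrite ler_pdivlMr//; apply: le_trans hm.
rewrite (_ : _ * N%:R = N%:R * (1 - 2 * e) * setnorm B); last by ring.
by rewrite ler_wpM2r ?normr_ge0// ltW.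
Qed.

End Concentration.

(** * The norm is the mean norm *)

Section Forward.
Variables (R : realType) (X : completeNormedModType R) (cls : X -> L0 R).
Hypothesis ri : rearrangement_invariant cls.
Local Notation mu := (mu01 R).
Local Notation setnorm := (setnorm cls).
Local Notation stepv := (stepv cls).
Implicit Types (x y z : X).

Lemma setnorm_cover L b c : (0 < b)%N -> 0 <= c ->
  (forall A : {set 'I_L}, (#|A| <= b)%N -> setnorm A <= c) ->
  forall Q : {set 'I_L}, setnorm Q <= (#|Q|%:R / b%:R + 1) * c.
Proof.
move=> b0 c0 hA Q; have [k] := ubnP #|Q|; elim: k Q => // k IH Q.
have bR : 0 < b%:R :> R by rewrite ltr0n.
have [Qb _|bQ] := leqP #|Q| b.
  by apply: le_trans (hA Q Qb) _; rewrite ler_peMl// lerDr divr_ge0// ltW.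
have [B BQ cB] := subset_of_card (ltnW bQ).
rewrite ltnS => Qk.
have QE : Q = (B :|: (Q :\: B))%SET.
  by rewrite -[LHS](finset.setID Q B) (finset.setIidPr BQ).
have cD : (#|Q| = b + #|Q :\: B|)%N.
  by rewrite -(cardsID B Q) (finset.setIidPr BQ) cB.
rewrite {1}QE; apply: le_trans (setnormU ri B (Q :\: B)%SET) _.
have hB : setnorm B <= c by apply: hA; rewrite cB.
have hQB : setnorm (Q :\: B)%SET <= (#|Q :\: B|%:R / b%:R + 1) * c.
  by apply: IH; apply: leq_trans Qk; rewrite cD -[ltnLHS]add0n ltn_add2r.
apply: le_trans (lerD hB hQB) _.
have -> : #|Q|%:R = b%:R + #|Q :\: B|%:R :> R by rewrite -natrD -cD.
by rewrite le_eqVlt; apply/orP; left; apply/eqP; field; rewrite gt_eqF.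
Qed.

Section Daugavet.
Hypothesis sepX : separable X.
Hypothesis dp : daugavet_property X.

(** A cell is covered by rearrangements of a much smaller set of cells, the
    norm of which is almost its measure. *)
Lemma setnorm_cell_approx N (i : 'I_N) M e : (0 < M)%N -> 0 < e -> e < 1 / 2 ->
  setnorm [set i]%SET * (1 - 2 * e) <= N%:R^-1 + M%:R^-1.
Proof.
move=> M0 e0 e2; have N0 : (0 < N)%N by case: i => i; exact: leq_trans.
have [q hq] := separable_small_cell ri sepX.
have [N1 [B [N10 B0 BM hB]]] := small_set ri dp hq M0 e0 e2.
pose L := (N1 * N)%N; have eL : L = (N1 * N)%N by [].
have eL' : L = (N * N1)%N by rewrite eL mulnC.
have n1 : setnorm [set i]%SET = setnorm [set l | blk eL' l \in [set i]]%SET.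
  by rewrite setnorm_blk.
have n2 : setnorm B = setnorm [set l | blk eL l \in B]%SET by rewrite setnorm_blk.
have c1 : #|[set l | blk eL' l \in [set i]]%SET| = N1.
  by rewrite (card_blk R)// cards1 muln1.
have c2 : #|[set l | blk eL l \in B]%SET| = (N * #|B|)%N by rewrite (card_blk R).
have e12 : 0 <= 1 - 2 * e by lra.
have b0 : (0 < N * #|B|)%N by rewrite muln_gt0 N0.
have cov (A : {set 'I_L}) : (#|A| <= N * #|B|)%N -> setnorm A <= setnorm B.
  by move=> cA; rewrite n2; apply: (setnorm_card ri); rewrite c2.
have := setnorm_cover b0 (normr_ge0 _) cov [set l | blk eL' l \in [set i]]%SET.
rewrite -n1 c1.
move=> /(ler_wpM2r e12)/le_trans; apply.
rewrite -mulrA; apply: le_trans (ler_wpM2l _ hB) _.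
  by rewrite addr_ge0// divr_ge0.
have B0' : 0 < #|B|%:R :> R by rewrite ltr0n.
have N10' : 0 < N1%:R :> R by rewrite ltr0n.
have N0' : 0 < N%:R :> R by rewrite ltr0n.
have M0' : 0 < M%:R :> R by rewrite ltr0n.
rewrite mulrDl mul1r lerD//.
  rewrite natrM le_eqVlt; apply/orP; left; apply/eqP; field.
  by rewrite !gt_eqF.
rewrite ler_pdivrMr// mulrC ler_pdivlMr// -natrM ler_nat.
exact: BM.
Qed.

Lemma setnorm_cell N (i : 'I_N) : setnorm [set i]%SET <= N%:R^-1.
Proof.
have N0 : (0 < N)%N by case: i => i; exact: leq_trans.
have s1 : setnorm [set i]%SET <= 1.
  rewrite -(setnorm_T ri N0); apply: (setnorm_card ri).
  by rewrite cards1 cardsT card_ord.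
rewrite leNgt; apply/negP => h.
set s := setnorm _ in s1 h; pose g := s - N%:R^-1.
have g0 : 0 < g by rewrite subr_gt0.
have Ni : 0 < N%:R^-1 :> R by rewrite invr_gt0 ltr0n.
have g1 : g <= 1 by rewrite /g; lra.
(* letting [M] tend to infinity and [e] to 0, quantitatively: both errors are
   at most a quarter of the gap [g] *)
pose M := (Num.trunc (4 / g)).+1.
have hM : M%:R^-1 < g / 4.
  rewrite -[ltRHS]invrK ltf_pV2 ?posrE ?ltr0n ?invr_gt0 ?divr_gt0// invf_div.
  exact: truncnS_gt.
have e0 : 0 < g / 8 by rewrite divr_gt0.
have e2 : g / 8 < 1 / 2 by lra.
have := setnorm_cell_approx i (ltn0Sn _ : (0 < M)%N) e0 e2.
rewrite -/s; have : s * (1 - 2 * (g / 8)) >= s - g / 4.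
  have : s * g <= 1 * g by rewrite ler_pM2r.
  by lra.
by move: hM; rewrite /g; lra.
Qed.

Lemma norm_stepv N (v : 'I_N -> R) : `|stepv v| <= norm1 (step v).
Proof.
rewrite norm1_step mulr_suml.
have -> : stepv v = \sum_i v i *: stepv (ind R [set i]%SET).
  rewrite -(eq_bigr _ (fun i _ => stepvZ ri (v i) (ind R [set i]%SET))) -(stepv_sum ri).
  congr stepv; apply/funext => j; rewrite (bigD1 j)//= /ind inE eqxx mulr1.
  by rewrite big1 ?addr0// => i ij; rewrite inE eq_sym (negbTE ij) mulr0.
apply: le_trans (ler_norm_sum _ _ _) _; apply: ler_sum => i _.
by rewrite normrZ ler_wpM2l// setnorm_cell.
Qed.

(** By [norm_stepv] and [norm_lsc], as step functions are dense in the mean. *)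
Lemma norm_norm1 x : `|x| = norm1 (cls x).
Proof.
apply/eqP; rewrite eq_le (norm1_le ri) andbT; apply/ler_addgt0Pr => d' d'0.
apply: (norm_lsc ri) => d d0.
have m0 : 0 < Num.min d d' by rewrite lt_min d0.
have lx := L1f_cls ri x.
have [N _ /(_ N (leqnn N))[v hv]] := step_dense lx m0.
have lv := L1f_step v.
have mx : measurable_fun setT (cls (stepv v)) by exact: measurable_cls.
exists (stepv v).
  apply: le_trans (norm_stepv v) _.
  have lz := L1fB lv lx.
  rewrite (_ : norm1 (step v) = norm1 (fun t => cls x t + (step v t - cls x t))).
    apply: le_trans (norm1D lx lz) _; rewrite lerD2l norm1C ltW//.
    by rewrite (lt_le_trans hv)// ge_min lexx orbT.
  by congr norm1; apply/funext => t; rewrite addrC subrK.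
apply: (@le_trans _ _ (norm1 (fun t => cls x t - step v t))).
  rewrite norm1C le_eqVlt; apply/orP; left; apply/eqP; apply: norm1_ae.
  - by apply: L1f_meas; apply: L1fB => //; exact: L1f_cls.
  - by apply: L1f_meas; exact: L1fB.
  - by apply: ae01S (cls_stepv ri v) => t ->.
by rewrite ltW// (lt_le_trans hv)// ge_min lexx.
Qed.

(** Step functions are dense in the mean, and a sequence of step functions that
    converges in the mean is a Cauchy sequence of the space. *)
Lemma L1f_member f : L1f f -> members cls f.
Proof.
move=> lf.
have hv n : exists y, norm1 (fun t => f t - cls y t) < n.+1%:R^-1.
  have n0 : 0 < n.+1%:R^-1 :> R by rewrite invr_gt0 ltr0n.
  have [N _ /(_ N (leqnn N))[v hv]] := step_dense lf n0.
  exists (stepv v); rewrite (_ : norm1 _ = norm1 (fun t => f t - step v t))//.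
  apply: norm1_ae.
  - by apply: L1f_meas; apply: L1fB => //; exact: L1f_cls.
  - by apply: L1f_meas; apply: L1fB => //; exact: L1f_step.
  - by apply: ae01S (cls_stepv ri v) => t ->.
have [u hu] := choice hv.
have dist x y : `|x - y| = norm1 (fun t => cls x t - cls y t).
  rewrite norm_norm1; apply: norm1_ae.
  - exact: measurable_cls.
  - by apply: L1f_meas; apply: L1fB; exact: L1f_cls.
  - exact: clsB.
have small (e : R) : 0 < e -> exists n, forall m, (n <= m)%N -> m.+1%:R^-1 < e.
  move=> e0; exists (Num.trunc e^-1) => m hm.
  rewrite -[ltRHS]invrK ltf_pV2 ?posrE ?ltr0n ?invr_gt0//.
  by rewrite (lt_le_trans (truncnS_gt _))// ler_nat ltnS.
have cu : cvg (u @ \oo).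
  apply/cauchy_cvgP/cauchy_exP => e /= e0.
  have e2 : 0 < e / 2 by rewrite divr_gt0.
  have [n hn] := small _ e2; exists (u n); exists n => // m /= nm.
  rewrite -ball_normE /ball_/= dist (splitr e).
  apply: le_lt_trans (norm1_triangle (L1f_cls ri _) lf (L1f_cls ri _)) _.
  rewrite ltrD//; last by apply: lt_trans (hu m) (hn m nm).
  by rewrite norm1C; apply: lt_trans (hu n) (hn n (leqnn n)).
pose x : X := lim (u @ \oo); exists x.
have lx := L1f_cls ri x; have lfx := L1fB lx lf.
apply: representsI; first exact: L1f_meas.
suff h0 : norm1 (fun t => cls x t - f t) = 0.
  by apply: ae01S (norm1_0_ae lfx h0) => t /eqP; rewrite subr_eq0 => /eqP.
apply/eqP; rewrite eq_le norm1_ge0 andbT; apply/ler_addgt0Pr => e e0; rewrite add0r.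
have e2 : 0 < e / 2 by rewrite divr_gt0.
have [n hn] := small _ e2.
have /(@cvgrPdist_lt _ _ _ _ _ _ _)/(_ _ e2)[m _ hm] := cu.
have := hm _ (leq_maxr n m); rewrite -/x dist => h1.
have := lt_trans (hu (maxn n m)) (hn _ (leq_maxl n m)) => h2.
apply: le_trans (norm1_triangle lx (L1f_cls ri (u (maxn n m))) lf) _.
rewrite (splitr e); apply: lerD; first exact: ltW h1.
by rewrite norm1C; exact: ltW h2.
Qed.

Lemma daugavet_equals_L1 : equals_L1 cls.
Proof.
split; last by move=> x; rewrite norm_norm1 EFin_integ01//; exact/L1f_norm/L1f_cls.
apply/seteqP; split => f.
  move=> [x /representsE[mf hx]]; apply/Lfun1_integrable.
  exact: L1f_ae mf hx (L1f_cls ri x).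
by move=> /= /Lfun1_integrable; exact: L1f_member.
Qed.

End Daugavet.
End Forward.

(** * The space of integrable functions has the Daugavet property *)

Section Backward.
Variables (R : realType) (X : completeNormedModType R) (cls : X -> L0 R).
Hypothesis ri : rearrangement_invariant cls.
Hypothesis isL1 : equals_L1 cls.
Local Notation mu := (mu01 R).
Implicit Types (x y z : X).

Lemma L1_norm x : `|x| = norm1 (cls x).
Proof. by apply: EFin_inj; rewrite isL1.2 EFin_integ01//; exact/L1f_norm/L1f_cls. Qed.

Lemma cls_sum n (y : 'I_n -> X) :
  {ae mu, forall t, cls (\sum_i y i) t = \sum_i cls (y i) t}.
Proof.
elim: n y => [|n IH] y.
  by rewrite big_ord0; apply: ae01S (cls0 ri) => t ->; rewrite big_ord0.
rewrite big_ord_recr/=; set w := fun i => y (widen_ord (leqnSn n) i).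
apply: (ae01S2 _ (IH w) (clsD ri (\sum_i w i) (y ord_max))) => t h ->.
by rewrite big_ord_recr/= h.
Qed.

Lemma cut_member N i x : exists y, {ae mu, forall t, cls y t = cls x t * \1_(cell N i) t}.
Proof.
have mc := @measurable_cell R N i.
have mx : measurable_fun setT (fun t => cls x t * \1_(cell N i) t).
  by apply: L1f_meas; apply: L1f_cut => //; exact: L1f_cls.
have [|y /representsE[_ hy] _] := koethe_ideal (ri_koethe ri) (x := x) mx; last by exists y.
by apply: aeW => t; rewrite normrM ler_piMr//; exact: indic_bdd.
Qed.

(** A step function that is close to [f] in the mean is bounded, so it has little
    mass on short intervals. *)
Lemma cell_mass (f : R -> R) d : L1f f -> 0 < d -> exists2 N, (0 < N)%N &
  forall i : 'I_N, norm1 (fun t => f t * \1_(cell N i) t) <= d.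
Proof.
move=> lf d0; have d2 : 0 < d / 2 by rewrite divr_gt0.
have [N0 _ /(_ N0 (leqnn N0))[v hv]] := step_dense lf d2.
pose V := \sum_i `|v i|; have V0 : 0 <= V by apply: sumr_ge0.
pose N := (Num.trunc (2 * V / d)).+1; exists N => // i.
have mc := @measurable_cell R N i.
have mi : measurable_fun setT (\1_(cell N i) : R -> R) by exact: measurable_indic.
have lv := L1f_step v; have lfv := L1fB lf lv.
have l1 := L1f_cut mc lfv; have l2 := L1f_cut mc lv.
apply: (@le_trans _ _ (norm1 (fun t => (f t - step v t) * \1_(cell N i) t + step v t * \1_(cell N i) t))).
  rewrite le_eqVlt; apply/orP; left; apply/eqP; congr norm1; apply/funext => t; ring.
apply: le_trans (norm1D l1 l2) _; rewrite [leRHS]splitr; apply: lerD.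
  have h1 := norm1M lfv mi (@indic_bdd R (cell N i)).
  by apply: (le_trans h1); rewrite mul1r ltW.
have lI : L1f (\1_(cell N i) : R -> R) by exact: L1f_indic.
rewrite (_ : (fun t => _) = (fun t => \1_(cell N i) t * step v t)); last first.
  by apply/funext => t; rewrite mulrC.
apply: le_trans (norm1M lI (measurable_step v) (step_bdd v)) _.
rewrite (_ : norm1 _ = N%:R^-1).
  rewrite ler_pdivrMr ?ltr0n// -/V.
  have := truncnS_gt (2 * V / d); rewrite -/N ltr_pdivrMr// => h; lra.
rewrite -(integ01_cell R i); congr integ01; apply/funext => t.
by rewrite indicE normr_nat.
Qed.

(** The mean norm is additive over cells, so the restriction of [x] to some cell,
    normalised, has an image at least as large as [T x]. If no cell carries much
    of the mass of [e], that vector is almost disjoint from the range of [T], and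
    the norms almost add up. *)
Lemma localize (T : {linear X -> X}) e x d : (forall z, exists a, T z = a *: e) ->
  `|x| <= 1 -> T x != 0 -> 0 < d -> d < 1 ->
  exists2 y, `|y| = 1 & 1 + `|T x| * (1 - d) <= `|y + T y|.
Proof.
move=> rT x1 Tx0 d0 d1.
have e0 : 0 < `|e|.
  rewrite normr_gt0; apply: contra_neq Tx0 => e0; have [a ->] := rT x.
  by rewrite e0 scaler0.
have d2 : 0 < d / 2 * `|e| by rewrite mulr_gt0// divr_gt0.
have [N N0 hN] := cell_mass (L1f_cls ri e) d2.
have [y hy] := choice (fun i : 'I_N => cut_member N i x).
have xE : x = \sum_i y i.
  apply: (cls_inj ri).
  have hs := cls_sum y.
  have hall : \forall t \ae mu, forall i, cls (y i) t = cls x t * \1_(cell N i) t.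
    exact: (@filter_forall _ _ _ (almost_everywhere mu) _ hy).
  have h01 : {ae mu, forall t, 0 <= t < 1} by apply: ae01.
  have h2 := ae01S2 (fun t a b => conj a b) hall h01.
  apply: (ae01S2 _ h2 hs) => t [ht /(cell_ex N0)[i it]] ->.
  rewrite (bigD1 i)//= big1 ?addr0 ?ht ?indicE ?mem_set ?mulr1// => j ji.
  rewrite ht indicE memNset ?mulr0// => jt; move/eqP: ji; apply; apply/val_inj.
  exact: (cell_uniq N0 jt it).
have lc i : L1f (fun t => cls x t * \1_(cell N i) t).
  by apply: L1f_cut; [exact: measurable_cell|exact: L1f_cls].
have yE (i : 'I_N) : `|y i| = norm1 (fun t => cls x t * \1_(cell N i) t).
  rewrite L1_norm; apply: norm1_ae => //; first exact: measurable_cls.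
  exact: L1f_meas.
have sy : \sum_i `|y i| <= 1.
  apply: le_trans x1; rewrite L1_norm.
  apply: le_trans (sum_integ01_cells N (L1f_norm (L1f_cls ri x)) (fun t => normr_ge0 _)).
  apply: ler_sum => i _; rewrite yE le_eqVlt; apply/orP; left; apply/eqP.
  by congr integ01; apply/funext => t; rewrite norm_cut.
(* otherwise, summing over the cells, all the restrictions [y i] vanish *)
have [i [yi0 Tyi]] : exists i, y i != 0 /\ `|T x| * `|y i| <= `|T (y i)|.
  apply: contrapT => /forallNP h.
  have h1 i : `|T (y i)| <= `|T x| * `|y i|.
    have [->|yi] := eqVneq (y i) 0; first by rewrite linear0 !normr0 mulr0.
    by rewrite leNgt; apply/negP => hlt; apply: (h i); split => //; exact: ltW.
  have h2 : `|T x| <= \sum_i `|T (y i)|.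
    by rewrite {1}xE linear_sum; exact: ler_norm_sum.
  have h3 : \sum_i (`|T x| * `|y i| - `|T (y i)|) <= 0.
    rewrite sumrB -mulr_sumr subr_le0; apply: le_trans h2.
    by rewrite -[leRHS]mulr1 ler_wpM2l.
  have h4 i : `|T x| * `|y i| - `|T (y i)| = 0.
    have h0 k : 0 <= `|T x| * `|y k| - `|T (y k)| by rewrite subr_ge0.
    apply: (psumr_eq0P (P := xpredT) (fun k _ => h0 k)) => //.
    by apply/eqP; rewrite eq_le h3 sumr_ge0.
  have h5 i : y i = 0.
    apply/eqP; apply: contrapT => /negP yi; apply: (h i); split => //.
    by move: (h4 i) => /eqP; rewrite subr_eq0 => /eqP ->.
  by move/eqP: Tx0; apply; rewrite xE big1 ?linear0.
have ny0 : 0 < `|y i| by rewrite normr_gt0.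
pose z := `|y i|^-1 *: y i.
have nz : `|z| = 1 by rewrite normrZ normfV normr_id mulVf// gt_eqF.
exists z => //.
have Tz : `|T x| <= `|T z|.
  by rewrite linearZ normrZ normfV normr_id ler_pdivlMl// mulrC.
have [b Tb] := rT z.
suff : 1 + `|T z| * (1 - d) <= `|z + T z|.
  by apply: le_trans; rewrite lerD2l ler_wpM2r// subr_ge0 ltW.
pose A : set R := cell N i; have mA : measurable A by exact: measurable_cell.
have le := L1f_cls ri e; have lz := L1f_cls ri z.
have leA := L1f_cut mA le.
have zA : {ae mu, forall t, cls z t = cls z t * \1_A t}.
  apply: (ae01S2 _ (clsZ ri `|y i|^-1 (y i)) (hy i)) => t -> ->.
  by rewrite indicE -!mulrA -natrM mulnb andbb.
have bn : `|T z| = `|b| * norm1 (cls e) by rewrite Tb normrZ L1_norm.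
have step1 : norm1 (cls z) + `|b| * norm1 (cls e)
    - 2 * (`|b| * norm1 (fun t => cls e t * \1_A t)) <= norm1 (fun t => cls z t + b * cls e t).
  rewrite /norm1 -!integ01Z; try exact: L1f_norm; last by apply: L1fZ; exact: L1f_norm.
  rewrite -integ01D; [|exact: L1f_norm|by apply: L1fZ; exact: L1f_norm].
  rewrite -integ01B; last 2 first.
  - by apply: L1fD; [exact: L1f_norm|apply: L1fZ; exact: L1f_norm].
  - by do 2 apply: L1fZ; exact: L1f_norm.
  apply: le_integ01.
  - apply: L1fB; first by apply: L1fD; [exact: L1f_norm|apply: L1fZ; exact: L1f_norm].
    by do 2 apply: L1fZ; exact: L1f_norm.
  - by apply: L1f_norm; apply: L1fD => //; exact: L1fZ.
  apply: ae01S zA => t ->; rewrite !normrM indicE normr_nat; case: (t \in A) => /=.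
    rewrite !mulr1; have := lerB_normD (cls z t) (b * cls e t).
    by rewrite normrM; lra.
  by rewrite !mulr0 !add0r subr0 normrM.
have -> : `|z + T z| = norm1 (fun t => cls z t + b * cls e t).
  rewrite L1_norm Tb; apply: norm1_ae; first exact: measurable_cls.
    by apply: L1f_meas; apply: L1fD => //; exact: L1fZ.
  by apply: (ae01S2 _ (clsZ ri b e) (clsD ri z (b *: e))) => t h ->; rewrite h.
apply: le_trans step1; rewrite -L1_norm nz bn.
have := ler_wpM2l (normr_ge0 b) (hN i); rewrite -/A -L1_norm.
by lra.
Qed.

(** One inequality is the triangle inequality. For the other, [localize] handles
    vectors outside the kernel, and the kernel is no constraint because [T] is
    not zero. *)
Lemma equals_L1_daugavet : daugavet_property X.
Proof.
move=> T _ [e e0 rT].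
have rT' z : exists a, T z = a *: e.
  have : range T (T z) by exists z.
  by rewrite rT => -[a _ <-]; exists a.
have [z0 Tz0] : exists z0, T z0 = e.
  have : range (fun a : R => a *: e) e by exists 1; rewrite // scale1r.
  by rewrite -rT => -[z _ <-]; exists z.
have key x : `|x| <= 1 -> T x != 0 ->
    ((1 + `|T x|)%:E <= opnorm (fun x => (x + T x)%R))%E.
  move=> x1 Tx0; apply/lee_addgt0Pr => d d0.
  have nT : 0 < `|T x| by rewrite normr_gt0.
  pose c := Num.min (1 / 2) (d / `|T x|).
  have c0 : 0 < c by rewrite lt_min !divr_gt0.
  have c1 : c < 1 by apply: le_lt_trans (_ : 1 / 2 < 1); [rewrite ge_min lexx|lra].
  have cd : `|T x| * c <= d by rewrite mulrC -ler_pdivlMr// ge_min lexx orbT.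
  have [y ny hy] := localize rT' x1 Tx0 c0 c1.
  apply: (@le_trans _ _ ((`|y + T y|)%:E + d%:E)%E).
    by rewrite -EFinD lee_fin; move: hy; rewrite mulrBr mulr1; lra.
  rewrite leeD2r//; apply: ereal_sup_ubound; exists y => //=.
  by rewrite ny.
apply/eqP; rewrite eq_le; apply/andP; split.
  apply: ge_ereal_sup => _ [x /= x1 <-].
  apply: (@le_trans _ _ (1 + `|T x|%:E)%E).
    by rewrite -EFinD lee_fin (le_trans (ler_normD _ _))// lerD2r.
  by rewrite leeD2l//; apply: ereal_sup_ubound; exists x.
rewrite addeC -leeBrDr//; apply: ge_ereal_sup => _ [x x1 <-]; rewrite /= in x1.
rewrite leeBrDr// addeC -EFinD.
have [Tx0|] := eqVneq (T x) 0; last exact: key.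
have z00 : 0 < `|z0|.
  by rewrite normr_gt0; apply: contra_neq e0 => h; rewrite -Tz0 h linear0.
rewrite Tx0 normr0 addr0.
have Tw : T (`|z0|^-1 *: z0) != 0.
  by rewrite linearZ Tz0 scaler_eq0 negb_or e0 invr_neq0// gt_eqF.
apply: le_trans (key _ _ Tw); first by rewrite lee_fin lerDl.
by rewrite normrZ normfV normr_id mulVf// gt_eqF.
Qed.
End Backward.

Theorem corollary4p9 (R : realType) (X : completeNormedModType R)
    (cls : X -> L0 R) (riX : rearrangement_invariant cls)
    (sepX : separable X) :
  daugavet_property X <-> equals_L1 cls.
Proof.
split; first exact: daugavet_equals_L1.
exact: equals_L1_daugavet.
Qed.
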